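(* For every integer $d \geq 2$ there exists an (explicit) constant $\epsilon_d > 0$, depending only on $d$, such that for every constant $c$ with $0 < c < \epsilon_d$ and every field $\mathbb{K}$, if $X \sim X(n, c/\sqrt[d]{n})$, then the Betti number $\beta_d(X; \mathbb{K}) = \dim_{\mathbb{K}} H_d(X; \mathbb{K})$ is asymptotically Poisson distributed with mean \[\frac{c^{2(d + 1)d}}{2^{d + 1}(d + 1)!},\] i.e. as $n \to \infty$ the random variable $\beta_d(X;\mathbb{K})$ converges in distribution to a Poisson random variable with this mean.
   Context: $G(n,p)$ is the Erdős–Rényi random graph on vertex set $[n]=\{1,\dots,n\}$, where each edge is included independently with probability $p$. The clique (flag) complex of a graph $G$ is the simplicial complex whose faces are the (vertex sets of) cliques of $G$. The random clique complex $X \sim X(n,p)$ is the clique complex of $G \sim G(n,p)$. *)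

(* Defs.v *)
From HB Require Import structures.
From mathcomp Require Import all_boot all_order all_algebra.
From mathcomp Require Import all_classical all_reals all_analysis.
Import numFieldNormedType.Exports.

Set Implicit Arguments.
Unset Strict Implicit.
Unset Printing Implicit Defensive.

Import Order.TTheory GRing.Theory Num.Theory.
Local Open Scope classical_set_scope.
Local Open Scope ring_scope.

Definition edge (n : nat) := {e : {set 'I_n} | #|e| == 2%N}.

HB.instance Definition _ n := Finite.on (edge n).

(* A simple graph on the vertex set ['I_n] is its set of edges. *)
Definition graph (n : nat) := {set edge n}.

HB.instance Definition _ n := Finite.on (graph n).

Definition is_clique n (G : graph n) (s : {set 'I_n}) : bool :=
  [forall e : edge n, (val e \subset s) ==> (e \in G)].

(* Faces are nonempty, so the homology below is unreduced. *)
Definition clique_complex n (G : graph n) : {set {set 'I_n}} :=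
  [set s | (s != finset.set0) && is_clique G s].

Lemma is_cliqueP n (G : graph n) (s : {set 'I_n}) :
  reflect
    (forall u v, u \in s -> v \in s -> u != v ->
       exists2 e : edge n, e \in G & val e = [set u; v]%SET)
    (is_clique G s).
Proof.
apply: (iffP forallP) => [cl u v us vs uv|cl e].
  have h : #|[set u; v]%SET| == 2%N by rewrite cards2 uv.
  exists (exist _ [set u; v]%SET h : edge n) => //.
  by have /implyP := cl (exist _ [set u; v]%SET h : edge n); apply => /=;
    apply/fintype.subsetP => x; rewrite !finset.inE => /orP[] /eqP->.
apply/implyP => es; have /cards2P[u [v [uv euv]]] := valP e.
have [us vs] : u \in s /\ v \in s.
  by split; apply: (fintype.subsetP es); rewrite euv !finset.inE eqxx ?orbT.
have [e' e'G e'E] := cl u v us vs uv.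
by rewrite (_ : e = e') //; apply: val_inj; rewrite e'E; exact: euv.
Qed.

Lemma clique_complex_closed n (G : graph n) (s t : {set 'I_n}) :
  s \in clique_complex G -> t \subset s -> t != finset.set0 ->
  t \in clique_complex G.
Proof.
rewrite !finset.inE => /andP[_ /forallP cl] ts ->/=.
apply/forallP => e; apply/implyP => et.
by apply: (implyP (cl e)); apply: fintype.subset_trans ts.
Qed.

Section Homology.
Variables (K : fieldType) (n : nat) (X : {set {set 'I_n}}).

(* The vertices are oriented by the order of ['I_n].
   Faces and chains are indexed by the number of vertices:
   [chain m] is the space of (m-1)-dimensional simplicial chains. *)
Definition face (m : nat) := {s : {set 'I_n} | (s \in X) && (#|s| == m)}.

HB.instance Definition _ m := Finite.on (face m).

Definition chain (m : nat) := {ffun face m -> K^o}.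

HB.instance Definition _ m := Vector.on (chain m).

(* [incidence s t] is the coefficient of [t] in the boundary of [s]: for
   s = {v_0 < ... < v_k} it is (-1)^i when t = s \ {v_i}, and 0 otherwise. *)
Definition vertex_rank (s : {set 'I_n}) (v : 'I_n) : nat :=
  #|[set u in s | (u < v)%N]%SET|.

Definition incidence (s t : {set 'I_n}) : K :=
  \sum_(v in s | s :\ v == t) (-1) ^+ vertex_rank s v.

Definition boundary_fun m (c : chain m.+1) : chain m :=
  [ffun t : face m => \sum_(s : face m.+1) incidence (val s) (val t) * c s].

Lemma boundary_fun_linear m : linear (@boundary_fun m).
Proof.
move=> a c1 c2; apply/ffunP => t; rewrite !ffunE.
rewrite /GRing.scale/= mulr_sumr -big_split/=; apply: eq_bigr => s _.
by rewrite !ffunE /GRing.scale/= mulrDr mulrCA.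
Qed.

HB.instance Definition _ m :=
  GRing.isLinear.Build K (chain m.+1) (chain m) *:%R (@boundary_fun m)
    (@boundary_fun_linear m).

Definition boundary m : 'Hom(chain m.+1, chain m) := linfun (@boundary_fun m).

Definition cycles (d : nat) : {vspace chain d.+1} := lker (boundary d).

Definition boundaries (d : nat) : {vspace chain d.+1} := limg (boundary d.+1).

(* The quotient Z_d / B_d is represented by a complement of B_d in Z_d
   (see [boundaries_sub_cycles] for B_d <= Z_d). *)
Definition homology (d : nat) : {vspace chain d.+1} :=
  (cycles d :\: boundaries d)%VS.

Definition betti (d : nat) : nat := \dim (homology d).

Lemma vertex_rank_swap (s : {set 'I_n}) (v w : 'I_n) :
  v \in s -> w \in s -> (v < w)%N ->
  (-1) ^+ vertex_rank s v * (-1) ^+ vertex_rank (s :\ v) w =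
  - ((-1) ^+ vertex_rank s w * (-1) ^+ vertex_rank (s :\ w) v) :> K.
Proof.
move=> vs ws vw.
have -> : vertex_rank s w = (vertex_rank (s :\ v) w).+1.
  rewrite /vertex_rank (cardsD1 v [set u in s | (u < w)%N]%SET).
  rewrite !finset.inE vs vw /= add1n; congr (_.+1); apply: eq_card => u.
  by rewrite !finset.inE andbA.
have -> : vertex_rank (s :\ w) v = vertex_rank s v.
  rewrite /vertex_rank; apply: eq_card => u; rewrite !finset.inE.
  by case: eqVneq => // ->; rewrite /= ltnNge (ltnW vw) andbF.
by rewrite exprS mulN1r mulNr opprK mulrC.
Qed.

Lemma incidence_incidence (s t : {set 'I_n}) :
  \sum_(v in s) (-1) ^+ vertex_rank s v * incidence (s :\ v) t = 0 :> K.
Proof.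
pose F v w : K := if (v \in s) && (w \in s) && (v != w) && (s :\ v :\ w == t)
  then (-1) ^+ vertex_rank s v * (-1) ^+ vertex_rank (s :\ v) w else 0.
have FE : \sum_v \sum_w F v w = 0.
  rewrite (eq_bigr (fun v : 'I_n => \sum_(w : 'I_n | (v < w)%N) F v w +
                             \sum_(w : 'I_n | (w < v)%N) F v w)); last first.
    move=> v _; rewrite (bigID (fun w : 'I_n => (v < w)%N))/=; congr (_ + _).
    rewrite (bigD1 v) ?ltnn//= [F v v]/F eqxx andbF/= add0r.
    by apply: eq_bigl => w; rewrite -leqNgt ltn_neqAle andbC.
  rewrite big_split/= [X in _ + X](exchange_big_dep xpredT)//= -big_split/=.
  apply: big1 => v _; rewrite -big_split/=; apply: big1 => w vw.
  rewrite /F [w == v]eq_sym [(w \in s) && _]andbC.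
  have -> : s :\ w :\ v = s :\ v :\ w.
    by apply/setP => u; rewrite !finset.inE andbCA.
  case: ifPn; last by rewrite addr0.
  by move=> /andP[/andP[/andP[vs ws] _] _]; rewrite vertex_rank_swap// addNr.
rewrite -[RHS]FE [in LHS]big_mkcond/=; apply: eq_bigr => v _.
case: ifPn => [vs|vs]; last by rewrite big1// => w _; rewrite /F (negPf vs).
rewrite /incidence mulr_sumr big_mkcond/=; apply: eq_bigr => w _.
by rewrite /F vs !finset.inE/= [w == v]eq_sym [(v != w) && _]andbC.
Qed.

Hypothesis X_closed : forall s t : {set 'I_n},
  s \in X -> t \subset s -> t != finset.set0 -> t \in X.

Lemma boundary_boundary m (c : chain m.+2) : boundary m (boundary m.+1 c) = 0.
Proof.
rewrite !lfunE/=; apply/ffunP => t; rewrite !ffunE/=.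
under eq_bigr do rewrite ffunE mulr_sumr.
rewrite exchange_big/= big1// => s _.
under eq_bigr do rewrite mulrA.
rewrite -mulr_suml (_ : \sum_i _ = 0) ?mul0r//.
rewrite -[RHS](incidence_incidence (val s) (val t)).
under eq_bigr do rewrite {2}/incidence mulr_sumr.
rewrite (exchange_big_dep (fun v => v \in val s))/=; last by move=> i j _ /andP[].
apply: eq_bigr => v vs.
have /andP[sX /eqP sc] := valP s.
have cv : #|val s :\ v| = m.+1 by move: sc; rewrite (cardsD1 v) vs => -[].
have h : (val s :\ v \in X) && (#|val s :\ v| == m.+1).
  rewrite cv eqxx andbT; apply: X_closed sX _ _; first exact: subsetDl.
  by rewrite -cards_eq0 cv.
rewrite (big_pred1 (exist _ (val s :\ v) h : face m.+1)) => [|r].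
  by rewrite mulrC.
by rewrite vs/= eq_sym.
Qed.

Lemma boundaries_sub_cycles d : (boundaries d <= cycles d)%VS.
Proof.
apply/subvP => _ /memv_imgP[c _ ->].
by rewrite memv_ker boundary_boundary.
Qed.

Lemma bettiE d : betti d = (\dim (cycles d) - \dim (boundaries d))%N.
Proof.
rewrite -(dimv_cap_compl (cycles d) (boundaries d)).
by rewrite (capv_idPr (boundaries_sub_cycles d)) addKn.
Qed.

End Homology.

HB.instance Definition _ n := isPointed.Build (graph n) finset.set0.

HB.instance Definition _ n := @isMeasurable.Build default_measure_display
  (graph n) discrete_measurable discrete_measurable0
  discrete_measurableC discrete_measurableU.

Definition gnp_pmf (R : realType) n (p : R) (G : graph n) : R :=
  \prod_(e : edge n) bernoulli_pmf p (e \in G).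

(* As for [bernoulli_prob], a Dirac mass (at the empty graph) is used as a
   default value when [p] is not in [0, 1]. *)
Definition gnp_prob (R : realType) n (p : R) : set (graph n) -> \bar R :=
  fun A => if 0 <= p <= 1 then (\sum_(G : graph n | G \in A) gnp_pmf p G)%:E
           else \d_(finset.set0 : graph n) A.

Section Gnp.
Context {R : realType} (n : nat) (p : R).

Local Notation gnp := (@gnp_prob R n p).

Lemma gnp_pmf_ge0 (G : graph n) : 0 <= p <= 1 -> 0 <= gnp_pmf p G.
Proof. by move=> p01; apply: prodr_ge0 => e _; exact: bernoulli_pmf_ge0. Qed.

Lemma gnp_pmf1 : \sum_(G : graph n) gnp_pmf p G = 1.
Proof.
transitivity (\prod_(e : edge n) (p + (1 - p))); last first.
  by rewrite big1// => e _; rewrite addrC subrK.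
rewrite bigA_distr /gnp_pmf; apply: eq_bigr => G _; apply: eq_bigr => e _.
by rewrite /bernoulli_pmf.
Qed.

(* The edges are present independently, each with probability [p]. *)
Lemma gnp_prob_edges (S T : {set edge n}) : 0 <= p <= 1 ->
  S :&: T = finset.set0 ->
  gnp [set G : {set edge n} | (S \subset G) && (G :&: T == finset.set0)] =
  (p ^+ #|S| * (1 - p) ^+ #|T|)%:E.
Proof.
move=> p01 ST; rewrite /gnp_prob p01; congr (_%:E).
pose E (e : edge n) : R := if e \in T then 0 else p.
pose F (e : edge n) : R := if e \in S then 0 else 1 - p.
have STF e : e \in S -> e \in T -> False.
  by move=> eS eT; have := finset.in_set0 e; rewrite -ST finset.inE eS eT.
transitivity (\prod_e (E e + F e)).
  rewrite bigA_distr.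
  rewrite big_mkcond/=; apply: eq_bigr => G _.
  rewrite mem_setE; case: ifPn => [/andP[/fintype.subsetP SG /eqP GT]|].
    apply: eq_bigr => e _; rewrite /E /F /bernoulli_pmf; case: ifPn => eG.
      by case: ifPn => // eT; have := finset.in_set0 e; rewrite -GT finset.inE eG eT.
    by case: ifPn => // /SG; rewrite (negPf eG).
  rewrite negb_and => /orP[/fintype.subsetPn[e eS eG]|/set0Pn[e]].
    by rewrite (bigD1 e)//= (negPf eG) /F eS mul0r.
  by rewrite finset.inE => /andP[eG eT]; rewrite (bigD1 e)//= eG /E eT mul0r.
rewrite -!prodr_const [X in _ = X * _]big_mkcond [X in _ = _ * X]big_mkcond/= -big_split/=.
apply: eq_bigr => e _; rewrite /E /F.
case: ifPn => [eT|eT]; case: ifPn => [eS|eS].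
- by case: (STF e).
- by rewrite mul1r add0r.
- by rewrite mulr1 addr0.
- by rewrite mulr1 addrC subrK.
Qed.

Let gnp0 : gnp set0 = 0%E.
Proof. by rewrite /gnp_prob measure0; case: ifPn => // _; rewrite big_pred0// => G; rewrite in_set0. Qed.

Let gnp_ge0 A : (0 <= gnp A)%E.
Proof.
rewrite /gnp_prob; case: ifPn => // p01; rewrite lee_fin.
by apply: sumr_ge0 => G _; exact: gnp_pmf_ge0.
Qed.

Let gnp_sigma_additive : semi_sigma_additive gnp.
Proof.
move=> F mF tF mUF; rewrite /gnp_prob; case: ifPn => p01; last first.
  exact: measure_semi_sigma_additive.
have pmf0 (G : graph n) : (0 <= (gnp_pmf p G)%:E)%E.
  by rewrite lee_fin gnp_pmf_ge0.
apply: cvg_toP.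
  apply: ereal_nondecreasing_is_cvgn => a b ab.
  apply: lee_sum_nneg_natr => // k _ _.
  by rewrite lee_fin sumr_ge0// => G _; exact: gnp_pmf_ge0.
have gnpE (A : set (graph n)) : (\sum_(G : graph n | G \in A) gnp_pmf p G)%:E =
    \esum_(G in A) (gnp_pmf p G)%:E.
  rewrite esum_fset//; last exact: finite_finset.
  rewrite -sumEFin bigfs ?index_enum_uniq//=; last first.
    by move=> G _; rewrite mem_index_enum.
  by rewrite set_mem_set.
transitivity (\sum_(0 <= i <oo) (\esum_(G in F i) (gnp_pmf p G)%:E))%E.
  by apply: eq_eseriesr => k _.
by rewrite -nneseries_sum_bigcup.
Qed.

HB.instance Definition _ := isMeasure.Build _ _ _ gnp
  gnp0 gnp_ge0 gnp_sigma_additive.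

Let gnp_setT : gnp [set: _] = 1%E.
Proof.
rewrite /gnp_prob probability_setT; case: ifPn => // p01.
rewrite -gnp_pmf1; congr (_%:E); apply: eq_bigl => G; exact: in_setT.
Qed.

HB.instance Definition _ := @Measure_isProbability.Build _ _ R gnp gnp_setT.

End Gnp.

(* Pointwise convergence of the cumulative distribution functions at the
   continuity points of the limit; the [X i] may live on different spaces. *)
Definition cvg_in_distribution (R : realType)
    (d : nat -> measure_display) (T : forall i, measurableType (d i))
    (P : forall i, probability (T i) R) (X : forall i, {RV P i >-> R})
    (d' : measure_display) (T' : measurableType d') (Q : probability T' R)
    (Y : {RV Q >-> R}) : Prop :=
  forall x : R, {for x, continuous (cdf Y)} ->
    cdf (X i) x @[i --> \oo] --> cdf Y x.

Section RandomVariables.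
Context {R : realType}.

Definition betti_real (K : fieldType) (d n : nat) (G : graph n) : R :=
  (betti K (clique_complex G) d)%:R.

HB.instance Definition _ K d n :=
  isMeasurableFun.Build _ _ (graph n) R (@betti_real K d n) (fun _ _ _ => I).

Definition betti_rv (K : fieldType) (d n : nat) (p : R) :
  {RV @gnp_prob R n p >-> R} := @betti_real K d n.

Definition nat_real (k : nat) : R := k%:R.

HB.instance Definition _ :=
  isMeasurableFun.Build _ _ nat R nat_real (fun _ _ _ => I).

(* The second argument of [poisson_prob] is a dummy. *)
Definition poisson_rv (rate : R) : {RV poisson_prob rate 0 >-> R} := nat_real.

End RandomVariables.

(* Main.v *)
(* Since n p^d = c^d, a prescribed graph with v vertices and more than d v edges
   occurs with expectation O(p).  Consider a d-cycle that is not homologous to a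
   combination of cross-polytopes, with minimal vertex set V and then minimal
   support.  It is strongly connected, and the link of each vertex carries a
   nontrivial (d-1)-cycle, so it has at least 2d vertices, with equality only
   for a cross-polytope.  Hence V spans more than d|V| edges, unless all links
   are cross-polytopes, in which case V itself is one.  Strongly connected sets
   with more than d|V| edges are excluded by a first moment bound over
   breadth-first orders: each new vertex is joined to a d-clique containing its
   parent, parents are monotone, and only boundedly many edges are in excess, so
   there are exponentially many shapes on k vertices and the sum over k converges
   for small c.  Thus the Betti number is the number N of cross-polytopes with
   high probability.

   N is asymptotically Poisson by size biasing: adding the edges of a given
   cross-polytope to the graph increases N by exactly one up to rare overlaps, so
   (k+1) P(N = k+1) - E(N) P(N = k) tends to 0, and E(N) tends to the rate. *)
From mathcomp Require Import all_classical all_reals all_analysis.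
From HB Require Import structures.
From mathcomp Require Import all_boot all_order all_algebra.
From mathcomp Require Import ring lra zify.
Require Import Defs.
Import numFieldNormedType.Exports.

Set Implicit Arguments.
Unset Strict Implicit.
Unset Printing Implicit Defensive.

Import Order.TTheory GRing.Theory Num.Theory.
Local Open Scope ring_scope.

(** * Chains of flag complexes *)

(** The critical balance is n^k p^(dk+1) = c^(dk) p: each fixed shape with one edge more than d per
    vertex is rare, but k is unbounded, so the obstacle is the number of shapes. A free choice of
    parents would cost a factor k per vertex, that is k^k; a monotone parent map costs at most 4^k
    in total, and the rest of an attaching clique is a subset of the parent's back-neighbourhood,
    whose size is bounded. The resulting exponential rate is what dictates the bound on c. The
    condition on links comes from a vanishing theorem: a flag complex on fewer than 2m vertices, or
    on 2m vertices without being a cross-polytope, has no reduced homology in degree m-1. When the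
    link part of a cycle bounds, coning moves the cycle off the vertex within its homology class,
    against minimality. Incidence signs are units, so the field does not matter. Generation by
    cross-polytopes gives only an upper bound on the Betti number. Independence needs their facets
    to be maximal faces and not shared: the values of a cycle at one facet per cross-polytope are
    then coordinates on homology. *)

Section FlagChains.
Variables (K : fieldType) (n : nat) (adj : rel 'I_n).
Hypothesis adjC : symmetric adj.
Implicit Types (s t f N U V : {set 'I_n}) (u v w : 'I_n) (c z : {set 'I_n} -> K).

Definition clique s := [forall u in s, forall v in s, (u != v) ==> adj u v].

Lemma cliqueP s :
  reflect {in s &, forall u v, u != v -> adj u v} (clique s).
Proof.
apply: (iffP forall_inP) => [cl u v us vs|cl u us].
  by have /forall_inP/(_ v vs)/implyP := cl u us.
by apply/forall_inP => v vs; apply/implyP; exact: cl.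
Qed.

Lemma cliqueS s t : t \subset s -> clique s -> clique t.
Proof.
move=> /subsetP ts /cliqueP cl; apply/cliqueP => u v ut vt.
by apply: cl; apply: ts.
Qed.

Definition nbrs V v := [set u in V | (u != v) && adj v u].
Definition nonnbrs V v := [set u in V | (u != v) && ~~ adj v u].

Lemma card_nbrs V v : v \in V -> (#|nbrs V v| + #|nonnbrs V v|).+1 = #|V|.
Proof.
move=> vV; rewrite [in RHS](cardsD1 v) vV add1n; congr _.+1.
rewrite -(cardsID [set u | adj v u] (V :\ v)); congr (_ + _)%N.
  by apply: eq_card => u; rewrite !inE; case: (u == v); case: (u \in V).
by apply: eq_card => u; rewrite !inE; case: (u == v); case: (u \in V); case: (adj v u).
Qed.

Lemma cliqueU1 s v : v \notin s ->
  clique (v |: s) = clique s && (s \subset nbrs [set: 'I_n] v).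
Proof.
move=> vs; apply/cliqueP/andP => [cl|[/cliqueP cl /subsetP sub] u w].
  split; first by apply/cliqueP => u w us ws; apply: cl; rewrite !inE ?us ?ws orbT.
  apply/subsetP => u us; rewrite !inE /=.
  have uv : u != v by apply: contraNneq vs => <-.
  by rewrite uv cl ?inE ?eqxx ?us ?orbT // eq_sym.
rewrite !inE => /predU1P[->|us] /predU1P[->|ws]; rewrite ?eqxx //.
- by move=> _; have := sub _ ws; rewrite !inE /= => /andP[].
- by move=> _; rewrite adjC; have := sub _ us; rewrite !inE /= => /andP[].
- exact: cl.
Qed.

Definition sgn t v : K := (-1) ^+ #|[set u in t | (u < v)%N]|.

Lemma sgnn t v : sgn t v * sgn t v = 1.
Proof. by rewrite /sgn -expr2 sqrr_sign. Qed.

Lemma sgn_neq0 t v : sgn t v != 0.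
Proof. by rewrite /sgn signr_eq0. Qed.

Lemma sgnU1 t u v : u \notin t -> sgn (u |: t) v = (-1) ^+ (u < v)%N * sgn t v.
Proof.
move=> ut; rewrite /sgn -exprD; congr (_ ^+ _).
rewrite (cardsD1 u [set w in u |: t | (w < v)%N]) !inE eqxx /=; congr (_ + _)%N.
apply: eq_card => w; rewrite !inE; case: eqVneq => //= ->.
by rewrite (negPf ut).
Qed.

Lemma sgn_swap t u v : u \notin t -> v \notin t -> u != v ->
  sgn (v |: t) u * sgn (u |: t) v = - (sgn t v * sgn t u).
Proof.
move=> ut vt uv; rewrite !sgnU1 // mulrACA -exprD.
have -> : ((v < u) + (u < v))%N = 1%N.
  by case: ltngtP uv => // /val_inj ->; rewrite eqxx.
by rewrite expr1 mulN1r mulrC.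
Qed.

(** Chains are functions on all vertex sets, so that one type serves every dimension and every
    induced subcomplex; [supported] records both. The empty set counts as a simplex, which makes
    this the augmented complex: links call for reduced homology. *)
Definition bd c t : K := \sum_(v | v \notin t) sgn t v * c (v |: t).
Definition cone v c s : K := if v \in s then sgn (s :\ v) v * c (s :\ v) else 0.
Definition lk v c t : K := if v \in t then 0 else sgn t v * c (v |: t).
Definition off v c t : K := if v \in t then 0 else c t.
Definition cycle c := forall t, bd c t = 0.

(* [supported V m c]: c is a chain of (m-1)-simplices in the flag complex
   induced on V. *)
Definition supported V m c :=
  forall s, c s != 0 -> [/\ s \subset V, #|s| = m & clique s].

Lemma supportedW U V m c : U \subset V -> supported U m c -> supported V m c.
Proof. by move=> UV sc s /sc[sU -> ->]; split=> //; exact: subset_trans UV. Qed.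

Lemma supportedD V m c z :
  supported V m c -> supported V m z -> supported V m (fun s => c s + z s).
Proof.
move=> sc sz s; case: (eqVneq (c s) 0) => [->|/sc//].
by rewrite add0r => /sz.
Qed.

Lemma supportedZ V m a c : supported V m c -> supported V m (fun s => a * c s).
Proof. by move=> sc s; rewrite mulf_eq0 negb_or => /andP[_ /sc]. Qed.

Lemma eq_bd c z : c =1 z -> bd c =1 bd z.
Proof. by move=> cz t; apply: eq_bigr => v _; rewrite cz. Qed.

Lemma bdD c z t : bd (fun s => c s + z s) t = bd c t + bd z t.
Proof. by rewrite /bd -big_split; apply: eq_bigr => v _; rewrite mulrDr. Qed.

Lemma bdZ a c t : bd (fun s => a * c s) t = a * bd c t.
Proof. by rewrite /bd mulr_sumr; apply: eq_bigr => v _; rewrite mulrCA. Qed.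

Lemma bd0 t : bd (fun=> 0) t = 0.
Proof. by apply: big1 => v _; rewrite mulr0. Qed.

(** The cone operator is a contracting homotopy. For v outside t only the term that adds v survives;
    for v in t the two insertions anticommute by [sgn_swap]. *)
Lemma bd_cone v c t : (forall s, v \in s -> c s = 0) ->
  bd (cone v c) t = c t - cone v (bd c) t.
Proof.
move=> cv; rewrite /cone; case: ifPn => vt; last first.
  rewrite subr0 /bd (bigD1 v) //= setU11 setU1K // mulrA sgnn mul1r.
  rewrite big1 ?addr0 // => u /andP[ut uv].
  by rewrite !inE (negPf vt) orbF eq_sym (negPf uv) mulr0.
rewrite cv // sub0r; set t' := t :\ v.
have tE : t = v |: t' by rewrite setD1K.
have vt' : v \notin t' by rewrite !inE eqxx.
rewrite [in RHS]/bd (bigD1 v) //= cv ?setU11 // mulr0 add0r mulr_sumr -sumrN.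
rewrite /bd; apply: eq_big => [u|u ut].
  by rewrite tE !inE negb_or andbC.
have uv : u != v by apply: contraNneq ut => ->.
have ut' : u \notin t' by rewrite !inE negb_and ut orbT.
have -> : (u |: t) :\ v = u |: t'.
  by apply/setP => x; rewrite !inE; case: (eqVneq x v) => //= ->; rewrite eq_sym (negPf uv).
by rewrite !inE vt orbT mulrA {1}tE sgn_swap // mulNr mulrA.
Qed.

Lemma off_cone_lk v c s : c s = off v c s + cone v (lk v c) s.
Proof.
rewrite /off /cone /lk; case: ifPn => vs; last by rewrite addr0.
by rewrite setD11 setD1K // mulrA sgnn mul1r add0r.
Qed.

Lemma lk_in v c s : v \in s -> lk v c s = 0.
Proof. by rewrite /lk => ->. Qed.

Lemma bd_in v c t : (forall s, v \in s -> c s = 0) -> v \in t -> bd c t = 0.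
Proof. by move=> cv vt; apply: big1 => u _; rewrite cv ?mulr0 // !inE vt orbT. Qed.

(** Apply [bd_cone] to the decomposition [off_cone_lk], and separate in the vanishing boundary the
    sets that contain v from those that do not. *)
Lemma bd_off_lk v c : cycle c ->
  (forall t, bd (off v c) t = - lk v c t) /\ cycle (lk v c).
Proof.
move=> cc.
have off_in s : v \in s -> off v c s = 0 by rewrite /off => ->.
have E t : bd (off v c) t + (lk v c t - cone v (bd (lk v c)) t) = 0.
  rewrite -bd_cone; last exact: lk_in.
  by rewrite -bdD -[RHS](cc t); apply: eq_bd => s; rewrite -off_cone_lk.
have bl : cycle (lk v c).
  move=> t; case: (boolP (v \in t)) => vt; first by rewrite (bd_in (v := v)) //; exact: lk_in.
  have := E (v |: t); rewrite (bd_in off_in) ?setU11 // lk_in ?setU11 //.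
  rewrite /cone setU11 setU1K // !add0r => /eqP.
  by rewrite oppr_eq0 mulf_eq0 (negPf (sgn_neq0 _ _)) => /eqP.
split=> // t; have := E t; rewrite /cone bl mulr0 if_same subr0 => /eqP.
by rewrite addr_eq0 => /eqP.
Qed.

Lemma supported_lk V m v c : supported V m.+1 c -> supported (nbrs V v) m (lk v c).
Proof.
move=> sc s; rewrite /lk; case: ifPn => [|vs]; first by rewrite eqxx.
rewrite mulf_eq0 negb_or => /andP[_ /sc[]].
rewrite subUset sub1set => /andP[vV sV].
rewrite cardsU1 vs add1n cliqueU1 // => -[->] /andP[-> /subsetP sN]; split=> //.
apply/subsetP => u us; have := sN _ us; rewrite !inE => /= ->.
by rewrite (subsetP sV).
Qed.

Lemma supported_off V m v c : supported V m c -> supported (V :\ v) m (off v c).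
Proof.
move=> sc s; rewrite /off; case: ifPn => [|vs]; first by rewrite eqxx.
by move=> /sc[sV -> ->]; rewrite subsetD1 sV vs.
Qed.

Lemma supported_cone V m v c : v \in V -> supported (nbrs V v) m c ->
  supported V m.+1 (cone v c).
Proof.
move=> vV sc s; rewrite /cone; case: ifPn => [vs|]; last by rewrite eqxx.
rewrite mulf_eq0 negb_or => /andP[_ /sc[sN sm scl]].
have /setD1K <- := vs; have v' : v \notin s :\ v by rewrite !inE eqxx.
rewrite subUset sub1set vV cardsU1 v' add1n sm cliqueU1 // scl /=; split=> //.
  by apply: subset_trans sN _; apply/subsetP => u; rewrite !inE => /andP[].
by apply: subset_trans sN _; apply/subsetP => u; rewrite !inE => /andP[_].
Qed.

Lemma supported_in V m v c : v \notin V -> supported V m c ->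
  forall s, v \in s -> c s = 0.
Proof.
move=> vV sc s vs; apply/eqP; apply: contraNT vV => /sc[/subsetP sV _ _].
exact: sV.
Qed.

Lemma notin_nbrs V v : v \notin nbrs V v.
Proof. by rewrite !inE eqxx andbF. Qed.

(* Coning off a bounding chain of the link of v pushes a cycle off v. *)
Lemma push_off V m v c b : v \in V -> supported V m.+1 c -> cycle c ->
    supported (nbrs V v) m.+1 b -> bd b =1 lk v c ->
  exists c', [/\ supported (V :\ v) m.+1 c', cycle c' &
    forall s, c s = c' s + bd (fun s => - 1 * cone v b s) s].
Proof.
move=> vV sc cc sb bE; exists (fun s => off v c s + b s); split.
- apply: supportedD; first exact: supported_off.
  apply: supportedW sb; apply/subsetP => u.
  by rewrite !inE => /and3P[-> ->].
- by move=> t; rewrite bdD (bd_off_lk v cc).1 bE addNr.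
- move=> s; rewrite bdZ bd_cone; last exact: supported_in (notin_nbrs V v) sb.
  rewrite [LHS](off_cone_lk v) mulN1r opprB.
  have -> : cone v (bd b) s = cone v (lk v c) s by rewrite /cone bE.
  by rewrite addrA -[in RHS]addrA addrC addrA; ring.
Qed.

(** Cocktail party graphs: their flag complexes are the boundaries of cross-polytopes. *)
Definition cocktail V := [forall v in V, #|nonnbrs V v| == 1%N].

(** Induction on m, then on the number of vertices: some vertex is either a cone point or has a link
    so small that its homology vanishes by induction, in which case the cycle is pushed off that
    vertex. *)
Lemma vanishing m V c : supported V m c -> cycle c ->
    (#|V| < m.*2)%N || (#|V| == m.*2) && ~~ cocktail V ->
  exists2 b, supported V m.+1 b & bd b =1 c.
Proof.
elim: m V c => [|m IHm] V c.
  rewrite ltn0 /= cards_eq0 => _ _ /andP[/eqP ->] /forall_inPn[v].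
  by rewrite inE.
have [k leVk] := ubnP #|V|; elim: k V leVk c => // k IHk V leVk c sc cc Vm.
have [V0|[v0 v0V]] := set_0Vmem V.
  exists (fun=> 0) => [s|t]; first by rewrite eqxx.
  rewrite bd0; apply/esym/eqP; apply/contraT => /sc[].
  by rewrite V0 subset0 => /eqP ->; rewrite cards0.
(* Below 2m + 2 vertices, a single nonneighbour already makes the link smaller than 2m. At 2m + 2
   vertices, v is taken where the cocktail condition fails: no nonneighbour, or at least two. *)
have [v vV vN] : exists2 v, v \in V & (#|nonnbrs V v| == 0%N) || (#|nbrs V v| < m.*2)%N.
  have key w : w \in V -> (#|nbrs V w| + #|nonnbrs V w|).+1 = #|V|.
    exact: card_nbrs.
  case/orP: Vm => [Vm|/andP[/eqP Vm /forall_inPn[v vV N1]]].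
    by exists v0 => //; have := key _ v0V; move: Vm; lia.
  by exists v => //; have := key _ vV; move: Vm N1; lia.
have VD : (#|V :\ v| < #|V|)%N by rewrite (cardsD1 v V) vV.
case/orP: vN => [|vN].
  (* Here v is adjacent to all the rest, so the complex is a cone with apex v, and the cone over the
     part of c off v bounds c. *)
  rewrite cards_eq0 => /eqP N0.
  exists (cone v (off v c)).
    apply: supported_cone => //.
    apply: supportedW (supported_off sc); apply/subsetP => u.
    rewrite !inE => /andP[uv uV]; rewrite uv uV.
    by apply: contraT => a; have := in_set0 u; rewrite -N0 !inE uV uv a.
  move=> t; rewrite bd_cone; last by move=> s; rewrite /off => ->.
  rewrite [RHS](off_cone_lk v); congr (_ + _).
  by rewrite /cone (bd_off_lk v cc).1; case: ifP; rewrite ?oppr0 // mulrN opprK.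
have [b sb bE] : exists2 b, supported (nbrs V v) m.+1 b & bd b =1 lk v c.
  apply: IHm; [exact: supported_lk|exact: (bd_off_lk v cc).2|by rewrite vN].
have [c' [sc' cc' cE]] := push_off vV sc cc sb bE.
have [b' sb' b'E] : exists2 b, supported (V :\ v) m.+2 b & bd b =1 c'.
  apply: IHk => //; first by apply: leq_trans VD _.
  by apply/orP; left; case/orP: Vm => [|/andP[/eqP]]; move: VD; lia.
exists (fun s => b' s + -1 * cone v b s).
  apply: supportedD; first by apply: supportedW sb'; exact: subD1set.
  by apply: supportedZ; exact: supported_cone.
by move=> t; rewrite bdD b'E cE.
Qed.

End FlagChains.

(** * Cross-polytopes and minimal cycles *)

Section Cocktail.
Variables (K : fieldType) (n : nat) (adj : rel 'I_n).
Hypothesis adjC : symmetric adj.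
Implicit Types (s t f N U V : {set 'I_n}) (u v w : 'I_n) (c z : {set 'I_n} -> K).

Local Notation clique := (clique adj).
Local Notation nbrs := (nbrs adj).
Local Notation nonnbrs := (nonnbrs adj).
Local Notation cocktail := (cocktail adj).
Local Notation supported := (supported adj).

Definition antipode V v := odflt v [pick u in nonnbrs V v].

Lemma nonnbrsE V v : cocktail V -> v \in V -> nonnbrs V v = [set antipode V v].
Proof.
move=> /forall_inP cV vV; have /cards1P[u uE] := cV v vV.
rewrite /antipode; case: pickP => [x|/(_ u)]; rewrite uE !inE ?eqxx //.
by move=> /eqP ->.
Qed.

Lemma antipodeP V v : cocktail V -> v \in V ->
  [/\ antipode V v \in V, antipode V v != v,
      antipode V (antipode V v) = v &
      forall u, u \in V -> u != v -> adj v u = (u != antipode V v)].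
Proof.
move=> cV vV; have E := nonnbrsE cV vV.
have : antipode V v \in nonnbrs V v by rewrite E set11.
rewrite !inE => /and3P[aV av na]; split=> //.
  have : v \in nonnbrs V (antipode V v) by rewrite !inE vV eq_sym av adjC na.
  by rewrite (nonnbrsE cV aV) inE => /eqP.
move=> u uV uv; have : (u \in nonnbrs V v) = (u == antipode V v) by rewrite E inE.
by rewrite !inE uV uv /= => <-; rewrite negbK.
Qed.

Lemma antipode_inj V : cocktail V -> {in V &, injective (antipode V)}.
Proof.
move=> cV u v uV vV e; have [_ _ <- _] := antipodeP cV uV.
by rewrite e; have [_ _ ->] := antipodeP cV vV.
Qed.

(** A clique is disjoint from its antipodal image; having m elements each, the two partition V. *)
Lemma clique_transversal V m s v : cocktail V -> #|V| = m.*2 ->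
  s \subset V -> #|s| = m -> clique s -> v \in V ->
  (antipode V v \in s) = (v \notin s).
Proof.
move=> cV Vm sV sm /cliqueP cl vV.
have sub u : u \in s -> u \in V by exact: subsetP.
have dis u : u \in s -> antipode V u \notin s.
  move=> us; have [aV au _ adjE] := antipodeP cV (sub _ us).
  by apply/negP => as_; have := cl _ _ us as_; rewrite eq_sym au adjE // eqxx => /(_ isT).
set a := [set antipode V u | u in s].
have aI : [disjoint s & a].
  rewrite -setI_eq0; apply/eqP/setP => u; rewrite !inE; apply/negbTE/negP.
  by move=> /andP[us /imsetP[x xs uE]]; have := dis _ xs; rewrite -uE us.
have ac : #|a| = m.
  by rewrite card_in_imset // => x y xs ys; apply: antipode_inj => //; exact: sub.
have UV : s :|: a = V.
  apply/eqP; rewrite eqEcard subUset sV /=; apply/andP; split.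
    by apply/subsetP => _ /imsetP[x xs ->]; have [] := antipodeP cV (sub _ xs).
  by rewrite cardsU (eqP (_ : s :&: a == set0)) ?setI_eq0 // cards0 sm ac Vm; lia.
have [aV av aa _] := antipodeP cV vV.
apply/idP/idP => [asn|vs]; first by rewrite -aa dis.
have : v \in s :|: a by rewrite UV.
rewrite inE (negPf vs) /= => /imsetP[x xs vE].
by rewrite vE; have [_ _ ->] := antipodeP cV (sub _ xs).
Qed.

(* A cycle takes the same value, up to sign, on two facets that differ by an
   antipodal flip. *)
Lemma cocktail_cycle_eq0 V m c f : cocktail V -> #|V| = m.*2 ->
    supported V m c -> cycle c -> f \subset V -> #|f| = m -> clique f ->
  c f = 0 -> c =1 fun=> 0.
Proof.
move=> cV Vm sc cc fV fm fcl cf s.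
have [k] := ubnP #|s :\: f|; elim: k s => // k IHk s sk.
apply/eqP; apply/contraT => cs; have [sV sm scl] := sc _ cs.
have [/eqP|[w]] := set_0Vmem (s :\: f).
  rewrite setD_eq0 => sf; have sE : s = f by apply/eqP; rewrite eqEcard sf sm fm /=.
  by rewrite sE cf eqxx in cs.
rewrite inE => /andP[wf ws]; have wV := subsetP sV _ ws.
set v := antipode V w; have [vV vw vwE _] := antipodeP cV wV.
have vf : v \in f by rewrite (clique_transversal cV Vm).
have vs : v \notin s by rewrite (clique_transversal cV Vm) ?ws.
set t := s :\ w; have wt : w \notin t by rewrite !inE eqxx.
have sE : s = w |: t by rewrite setD1K.
have vt : v \notin t by rewrite !inE negb_and vs orbT.
have cv : c (v |: t) = 0.
  apply: IHk; apply: leq_trans (_ : #|s :\: f| <= _)%N => //.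
  apply: proper_card; apply/properP; split.
    apply/subsetP => x; rewrite !inE => /andP[xf /predU1P[xv|/andP[_ xs]]].
      by rewrite xv vf in xf.
    by rewrite xf xs.
  by exists w; rewrite !inE ?wf ?ws // eqxx (eq_sym w v) (negPf vw) andbF.
(* By transversality only [w |: t] and [v |: t] can carry c among the sets extending t by one
   vertex, so the boundary at t ties their values together. *)
have := cc t; rewrite /bd (bigD1 w) //= (bigD1 v) /=; last by rewrite vt vw.
rewrite cv mulr0 add0r big1 ?addr0 => [|u /andP[/andP[ut uw] uv]].
  by move/eqP; rewrite mulf_eq0 (negPf (sgn_neq0 _ _ _)) -sE (negPf cs).
apply/eqP; rewrite mulf_eq0; apply/orP; right; apply/contraT => /sc[uV um ucl].
have := clique_transversal cV Vm uV um ucl wV.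
have := clique_transversal cV Vm uV um ucl vV.
rewrite vwE -/v !in_setU1 (negPf wt) (negPf vt) !orbF.
by rewrite (eq_sym w) (eq_sym v) (negPf uw) (negPf uv).
Qed.

Lemma nbrs_cocktail V v : cocktail V -> v \in V ->
  nbrs V v = V :\ v :\ antipode V v.
Proof.
move=> cV vV; have [aV av _ adjE] := antipodeP cV vV.
apply/setP => u; rewrite !inE; case: (boolP (u \in V)) => uV; rewrite ?andbF //=.
by case: (eqVneq u v) => [->|uv]; rewrite ?andbF //= adjE ?andbT.
Qed.

Lemma cocktail_nbrs V v : cocktail V -> v \in V -> cocktail (nbrs V v).
Proof.
move=> cV vV; have [aV av aa _] := antipodeP cV vV.
apply/forall_inP => u; rewrite nbrs_cocktail // !inE => /and3P[ua uv uV].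
have /forall_inP/(_ u uV)/eqP <- := cV; apply/eqP/eq_card => x.
rewrite !inE; case: (boolP (x \in V)) => xV; rewrite ?andbF //=.
have [bV bu bb adjE] := antipodeP cV uV.
case: (eqVneq x u) => xu; rewrite ?andbF //= adjE // negbK andbC.
case: eqP => //= ->; apply/andP; split.
  by apply: contraNneq uv => /(antipode_inj cV uV vV) ->.
by rewrite andbT; apply: contraNneq ua => <-; rewrite bb.
Qed.

(** V is the suspension of the link of v, with apexes v and its antipode, whose links coincide; the
    difference of the two cones over a cycle of the link is a cycle. The induction starts with the
    empty simplex of the augmented complex. *)
Lemma cocktail_cycle_exists m V : cocktail V -> #|V| = m.*2 ->
  exists c f, [/\ supported V m c, cycle c & c f != 0].
Proof.
elim: m V => [|m IHm] V cV Vm.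
  have V0 : V = set0 by apply/eqP; rewrite -cards_eq0 Vm.
  exists (fun s => (s == set0)%:R), set0; rewrite eqxx oner_eq0; split=> //.
    move=> s /=; case: (s =P set0) => [->|_]; last by rewrite eqxx.
    by rewrite sub0set cards0; split=> //; apply/cliqueP => u; rewrite inE.
  move=> t; apply: big1 => v _; case: (v |: t =P set0) => [e|_]; last by rewrite mulr0.
  by have := in_set0 v; rewrite -e setU11.
have /card_gt0P[v vV] : (0 < #|V|)%N by rewrite Vm.
set w := antipode V v; have [wV wv wvE _] := antipodeP cV vV; rewrite -/w in wV wv wvE.
have NE : nbrs V w = nbrs V v.
  rewrite !nbrs_cocktail // -/w wvE.
  by apply/setP => x; rewrite !inE andbCA.
have vN : v \notin nbrs V v by rewrite notin_nbrs.
have wN : w \notin nbrs V v by rewrite -NE notin_nbrs.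
have [||c [f [sc cc cf]]] := IHm (nbrs V v); first exact: cocktail_nbrs.
  rewrite nbrs_cocktail //; apply/eqP; move: Vm.
  by rewrite (cardsD1 v) vV (cardsD1 w (V :\ v)) !inE wv wV doubleS => -[<-].
exists (fun s => cone v c s + -1 * cone w c s), (v |: f).
have vf : v \notin f by apply: contraNN cf => /(supported_in vN sc) ->.
have wf : w \notin f by apply: contraNN cf => /(supported_in wN sc) ->.
split.
- apply: supportedD; first exact: supported_cone.
  by apply: supportedZ; apply: supported_cone => //; rewrite NE.
- move=> t; rewrite bdD bdZ !bd_cone; try exact: supported_in sc.
  by rewrite /cone !cc !mulr0 !if_same; ring.
rewrite /cone setU11 setU1K // !inE (negPf wf) (negPf wv) /= mulr0 addr0.
by rewrite mulf_neq0 // sgn_neq0.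
Qed.

(* The outer neighbours of the link of v all coincide: in the link of u, the
   antipode of v is adjacent to every other vertex. *)
Lemma cocktail_spread V d v : (2 <= d)%N -> v \in V ->
    {in V, forall u, #|nbrs V u| = d.*2 /\ cocktail (nbrs V u)} ->
  exists2 U : {set 'I_n}, [/\ v \in U, cocktail U & #|U| = d.+1.*2] &
    U \subset V /\ {in U, forall u, nbrs V u \subset U}.
Proof.
move=> d2 vV H; set N := nbrs V v; have [Nc cN] := H _ vV; rewrite -/N in Nc cN.
have NV u : u \in N -> u \in V by rewrite inE => /andP[].
have vN : v \notin N by rewrite notin_nbrs.
have cardN u : u \in N -> (#|nbrs N u|).+2 = d.*2.
  move=> uN; rewrite -Nc -(card_nbrs adj uN) (eqP (forall_inP cN u uN)).
  by rewrite addn1.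
have avN u : u \in N -> adj u v by rewrite inE adjC => /and3P[].
have nbN u : u \in N -> nbrs N u \subset nbrs V u.
  move=> uN; apply/subsetP => x; rewrite !inE => /and3P[/andP[xV _] xu ->].
  by rewrite xu xV.
have vnb u : u \in N -> v \in nbrs V u.
  move=> uN; rewrite inE vV avN // andbT.
  by apply: contraNneq vN => ->.
(* In the link of u the outer vertex w is not adjacent to v, and a vertex has only one nonneighbour
   there. *)
have prop u w x : u \in N -> w \in nbrs V u -> w \notin N -> w != v ->
    x \in nbrs N u -> adj x w.
  move=> uN wu wN wv xu; apply: contraT => nxw.
  have xN : x \in N by move: xu; rewrite inE => /andP[].
  have wV : w \in V by move: wu; rewrite inE => /andP[].
  have [_ cu] := H _ (NV _ uN).
  have /cards1P[y yE] := forall_inP cu w wu.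
  have vy : v == y.
    rewrite -in_set1 -yE inE vnb // eq_sym wv /= adjC; apply: contraNN wN => a.
    by rewrite inE wV wv.
  have xy : x == y.
    rewrite -in_set1 -yE inE (subsetP (nbN _ uN)) //= adjC nxw andbT.
    by apply: contraNneq wN => <-.
  by move: vN; rewrite (eqP vy) -(eqP xy) xN.
have /card_gt0P[u0 u0N] : (0 < #|N|)%N by rewrite Nc double_gt0; lia.
(* The link of u0 has 2d vertices, of which v and the neighbours of u0 in N are only 2d - 1. *)
have [w [wu wN wv]] : exists w, [/\ w \in nbrs V u0, w \notin N & w != v].
  have : ~~ (nbrs V u0 \subset v |: nbrs N u0).
    apply/negP => /subset_leq_card; have [-> _] := H _ (NV _ u0N).
    rewrite cardsU1 -(cardN _ u0N).
    by case: (_ \notin _); lia.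
  case/subsetPn => w wu; rewrite !inE negb_or negb_and => /andP[wv wN].
  exists w; split=> //; move: wN wu; rewrite !inE.
  by case: (w \in V) => //=; case: (_ != v) => //=; case: (w != u0); case: (adj u0 w);
     rewrite //= ?andbT ?orbF.
have wV : w \in V by move: wu; rewrite inE => /andP[].
(* From u0, [prop] reaches all of N except the antipode of u0; that one is reached through a common
   neighbour y, which exists because d >= 2. *)
have Nw x : x \in N -> adj x w.
  move=> xN; have [aN au aa adjE] := antipodeP cN u0N.
  case: (eqVneq x u0) => [->|xu0]; first by move: wu; rewrite inE => /and3P[].
  case: (eqVneq x (antipode N u0)) => [xa|xa]; last first.
    by apply: (prop u0) => //; rewrite inE xN xu0 adjE.
  have /card_gt0P[y yu] : (0 < #|nbrs N u0|)%N by move: (cardN _ u0N) d2; clear; lia.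
  have [yN yu0] : y \in N /\ y != u0 by move: yu; rewrite inE => /and3P[].
  have ya : y != antipode N u0.
    by move: yu; rewrite inE adjE // => /and3P[].
  have wy : w \in nbrs V y.
    rewrite inE wV (prop u0) // andbT.
    by apply: contraNneq wN => ->.
  apply: (prop y) => //; rewrite inE xN xa eq_sym ya.
  have [_ _ _ adjE'] := antipodeP cN yN.
  rewrite adjE' //; last by rewrite eq_sym.
  by apply: contraNneq yu0 => /(antipode_inj cN u0N yN) ->.
have nbw : nbrs V w = N.
  apply/eqP; rewrite eq_sym eqEcard Nc; have [-> _] := H _ wV; rewrite leqnn andbT.
  apply/subsetP => x xN; rewrite inE NV // adjC Nw // andbT.
  by apply: contraNneq wN => <-.
have nbu u : u \in N -> nbrs V u = v |: (w |: nbrs N u).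
  move=> uN; apply/eqP; rewrite eq_sym eqEcard.
  have [-> _] := H _ (NV _ uN).
  have wn : w \notin nbrs N u by rewrite inE negb_and wN.
  have vn : v \notin w |: nbrs N u.
    by rewrite in_setU1 negb_or eq_sym wv inE negb_and vN.
  rewrite !cardsU1 vn wn /= !add1n cardN // leqnn andbT !subUset !sub1set vnb //= nbN // andbT.
  rewrite inE wV Nw // andbT.
  by apply: contraNneq wN => ->.
set U := v |: (w |: N).
have UV : U \subset V.
  by rewrite !subUset !sub1set vV wV; apply/subsetP.
have clU : {in U, forall u, nbrs V u \subset U}.
  move=> u; rewrite !in_setU1 => /or3P[/eqP->|/eqP->|].
  - by rewrite -/N /U setUA subsetUr.
  - by rewrite nbw /U setUA subsetUr.
  move=> uN; rewrite nbu //; apply: setUS; apply: setUS.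
  by apply/subsetP => x; rewrite inE => /andP[].
have cU : #|U| = d.+1.*2.
  by rewrite !cardsU1 in_setU1 wN negb_or (eq_sym v) wv vN Nc doubleS.
exists U => //; split=> //; first by rewrite setU11.
apply/forall_inP => u uU; have uV := subsetP UV _ uU.
have := card_nbrs adj uU.
have -> : nbrs U u = nbrs V u.
  apply/setP => x; apply/idP/idP => [|xu].
    by rewrite inE => /andP[xU xN]; rewrite inE xN (subsetP UV).
  by rewrite inE (subsetP (clU _ uU)) //; move: xu; rewrite inE => /andP[].
by have [-> _] := H _ uV; rewrite cU; clear; lia.
Qed.

(** Both generating families are stable under scalars, so this describes a subspace: the cycles
    homologous to combinations of cross-polytope cycles. *)
Inductive generated d : ({set 'I_n} -> K) -> Prop :=
| generated_bd b : supported [set: 'I_n] d.+2 b -> generated d (bd b)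
| generated_cocktail V c : cocktail V -> #|V| = d.+1.*2 ->
    supported V d.+1 c -> cycle c -> generated d c
| generatedD c z : generated d c -> generated d z ->
    generated d (fun s => c s + z s)
| generated_eq c z : c =1 z -> generated d c -> generated d z.

(* V is exhausted from R by repeatedly attaching a vertex to a d-clique. *)
Definition tree_spanned d (V R : {set 'I_n}) :=
  [/\ R \subset V, #|R| = d.+1, clique R &
   forall U : {set 'I_n}, R \subset U -> U \proper V ->
     exists v (t : {set 'I_n}), [/\ v \in V :\: U, t \subset U, #|t| = d & clique (v |: t)]].

(** Purely deterministic: the random graph enters only through the degree sums of tree-spanned sets.
    The outer induction is on the number of vertices and the inner one on the size of the support,
    so a counterexample can be taken minimal in both. *)
Lemma generated_cycle d : (2 <= d)%N ->
    (forall V R, tree_spanned d V R ->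
       (\sum_(v in V) #|nbrs V v| <= d.*2 * #|V|)%N) ->
  forall V c, supported V d.+1 c -> cycle c -> generated d c.
Proof.
move=> d2 sparse V; have [k leVk] := ubnP #|V|; elim: k V leVk => // k IHk V leVk c.
have [l] := ubnP #|[set s | c s != 0]|; elim: l c => // l IHl c lec sc cc.
apply: contrapT => ngen.
have [R cR] : exists R, c R != 0.
  apply/not_existsP => c0; apply: ngen.
  apply: (@generated_eq _ (bd (fun=> 0))); last first.
    by apply: generated_bd => s; rewrite eqxx.
  by move=> s; rewrite bd0; apply/esym/eqP/negPn/negP/c0.
have cover v : v \in V -> exists2 s, c s != 0 & v \in s.
  move=> vV; apply: contrapT => nv; apply: ngen.
  apply: (IHk (V :\ v)) => //.
    by apply: leq_trans (proper_card (properD1 vV)) _.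
  move=> s cs; have [sV -> ->] := sc s cs; split=> //.
  by rewrite subsetD1 sV; apply/negP => vs; apply: nv; exists s.
(* Otherwise [vanishing] makes the link part of c a boundary, and [push_off] replaces c by a cycle
   on fewer vertices. *)
have link v : v \in V ->
    (d.*2 <= #|nbrs V v|)%N /\ (#|nbrs V v| = d.*2 -> cocktail (nbrs V v)).
  move=> vV; apply: contrapT => nv; apply: ngen.
  have [b sb bE] : exists2 b, supported (nbrs V v) d.+1 b & bd b =1 lk v c.
    apply: vanishing => //; [exact: supported_lk|exact: (bd_off_lk v cc).2|].
    case: ltngtP => //= h.
      by exfalso; apply: nv; split=> [|e]; [exact: ltnW|rewrite e ltnn in h].
    by apply/negP => cN; apply: nv; rewrite h.
  have [c' [sc' cc' cE]] := push_off vV sc cc sb bE.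
  apply: (@generated_eq _ (fun s => c' s + bd (fun s => - 1 * cone v b s) s)) => [s|].
    by rewrite cE.
  apply: generatedD.
    apply: (IHk (V :\ v)) => //.
    by apply: leq_trans (proper_card (properD1 vV)) _.
  apply: generated_bd; apply: supportedZ.
  by apply: supportedW (subsetT V) _; exact: supported_cone.
(* Cut c along U. If the part inside U were a cycle, both parts would be cycles of smaller support.
   So some t has nonzero boundary in both parts: it lies in a facet inside U and in a facet that
   leaves U. *)
have tree s : c s != 0 -> tree_spanned d V s.
  move=> cs; have [sV sd scl] := sc _ cs; split=> // U sU /properP[UV [x xV xU]].
  have [s0 cs0 xs0] := cover _ xV.
  pose cU (r : {set 'I_n}) := if r \subset U then c r else 0.
  pose cU' (r : {set 'I_n}) := if r \subset U then 0 else c r.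
  have cE r : c r = cU r + cU' r.
    by rewrite /cU /cU'; case: ifP; rewrite ?addr0 ?add0r.
  have bE r : bd cU r + bd cU' r = 0.
    by rewrite -bdD -(cc r); apply: eq_bd => q; rewrite cE.
  have scU : supported V d.+1 cU.
    by move=> r; rewrite /cU; case: ifP; rewrite ?eqxx // => _ /sc.
  have scU' : supported V d.+1 cU'.
    by move=> r; rewrite /cU'; case: ifP; rewrite ?eqxx // => _ /sc.
  have [t bt] : exists t, bd cU t != 0.
    apply/not_existsP => b0; apply: ngen.
    have cycU : cycle cU by move=> r; apply/eqP/negPn/negP/b0.
    apply: (@generated_eq _ (fun r => cU r + cU' r)) => [r|]; first by rewrite -cE.
    apply: generatedD; apply: IHl => //.
    - apply: leq_trans (proper_card (_ : _ \proper [set r | c r != 0])) lec.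
      apply/properP; split.
        by apply/subsetP => r; rewrite !inE /cU; case: ifP; rewrite ?eqxx.
      exists s0; rewrite !inE // negbK /cU; case: ifP => // /subsetP/(_ _ xs0).
      by rewrite (negPf xU).
    - apply: leq_trans (proper_card (_ : _ \proper [set r | c r != 0])) lec.
      apply/properP; split.
        by apply/subsetP => r; rewrite !inE /cU'; case: ifP; rewrite ?eqxx.
      by exists s; rewrite !inE // negbK /cU' sU.
    - by move=> r; have := bE r; rewrite cycU add0r.
  have term z : bd z t != 0 -> exists2 y, y \notin t & z (y |: t) != 0.
    move=> zt; apply: contrapT => nz; move/eqP: zt; apply; apply: big1 => y yt.
    suff -> : z (y |: t) = 0 by rewrite mulr0.
    by apply/eqP/negPn/negP => zy; apply: nz; exists y.
  have bt' : bd cU' t != 0.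
    by move: (bE t) => /eqP; rewrite addr_eq0 => /eqP e; rewrite e oppr_eq0 in bt.
  have [y yt] := term _ bt; have [v vt] := term _ bt'.
  rewrite /cU' /cU; case: ifP => [|nvU cv]; first by rewrite eqxx.
  case: ifP => [|_]; last by rewrite eqxx.
  rewrite subUset => /andP[_ tU] _.
  have [vtV vtd vtcl] := sc _ cv.
  exists v, t; split=> //.
    rewrite inE (subsetP vtV) ?setU11 // andbT.
    by apply: contraFN nvU => vU; rewrite subUset sub1set vU.
  by move: vtd; rewrite cardsU1 vt => -[].
have [RV Rd Rcl Rtree] := tree _ cR.
(* All degrees are at least 2d while their average is at most 2d. *)
have deg : {in V, forall u, #|nbrs V u| = d.*2 /\ cocktail (nbrs V u)}.
  move=> u uV; have [le1 cN] := link _ uV.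
  suff e : #|nbrs V u| = d.*2 by split; [|exact: cN].
  apply/eqP; rewrite eqn_leq le1 andbT.
  have := sparse _ _ (tree _ cR); rewrite (bigD1 u) //= (cardsD1 u V) uV mulnS.
  have : (\sum_(i in V | i != u) d.*2 <= \sum_(i in V | i != u) #|nbrs V i|)%N.
    by apply: leq_sum => i /andP[iV _]; have [] := link _ iV.
  rewrite sum_nat_const.
  have -> : #|[pred i in V | i != u]| = #|V :\ u|.
    by apply: eq_card => i; rewrite !inE andbC.
  rewrite mulnC => a b; rewrite -(leq_add2r (d.*2 * #|V :\ u|)).
  by apply: leq_trans b; rewrite leq_add2l.
have /card_gt0P[v vR] : (0 < #|R|)%N by rewrite Rd.
have vV := subsetP RV _ vR.
have [U [vU cU Ud] [UV Ucl]] := cocktail_spread d2 vV deg.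
have RU : R \subset U.
  apply/subsetP => x xR; case: (eqVneq x v) => [->//|xv].
  apply: (subsetP (Ucl _ vU)); rewrite inE (subsetP RV) // xv /=.
  by move/cliqueP: Rcl; apply=> //; rewrite eq_sym.
(* U is closed under adjacency in V, so no vertex outside U can be attached to a clique inside U. *)
have VU : V = U.
  apply/eqP; rewrite eq_sym eqEproper UV /=; apply/negP => pU.
  have [y [t [yVU tU td /cliqueP ycl]]] := Rtree _ RU pU.
  have /card_gt0P[x xt] : (0 < #|t|)%N by rewrite td ltnW.
  move: yVU; rewrite inE => /andP[yU yV]; move/negP: yU; apply.
  have xU := subsetP tU _ xt.
  have yU : y \notin U -> y != x by apply: contraNneq => ->.
  case: (boolP (y \in U)) => // /[dup] /yU yx /negP yU'; exfalso; apply: yU'.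
  apply: (subsetP (Ucl _ xU)); rewrite inE yV yx.
  by apply: ycl; rewrite ?inE ?eqxx ?xt ?orbT // eq_sym.
by apply: ngen; rewrite -VU in cU Ud; apply: generated_cocktail sc cc.
Qed.

End Cocktail.

(** * Counting building sequences *)

Section Shapes.
Variable d : nat.

(* A shape on k vertices has d k + 1 edges, whereas a (d+1)-clique extended by
   k - d - 1 vertices of back-degree d has d k - 'C(d+1, 2). *)
Definition excess := 'C(d.+1, 2).+1.
(** A bound on the size of every back-neighbourhood: at most d vertices of the attaching clique and
    at most [excess] others. A mask thus has boundedly many bits. *)
Definition mask_size := (d + excess)%N.

Definition code k :=
  (k.-tuple 'I_k * {ffun 'I_k -> {set 'I_mask_size}} * {set 'I_k * 'I_k})%type.

(* Vertices are added in the order 0, 1, ..., k-1 and [B i] is the set of earlier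
   neighbours of [i].  Past the initial clique, [i] is joined to its parent
   [tnth c.1.1 i], to the neighbours of the parent selected by the mask
   [c.1.2 i], and by the extra edges in [c.2]. *)
Definition coded k (B : {ffun 'I_k -> {set 'I_k}}) (c : code k) :=
  [forall i : 'I_k, if (i <= d)%N then B i == [set j : 'I_k | (j < i)%N]
    else let u := tnth c.1.1 i in
      (u < i)%N && (B i == (u |: [set j in B u |
         [exists a in c.1.2 i, val a == index j (enum (B u))]])
                     :|: [set j | (i, j) \in c.2])].

(** Sortedness is what keeps the count exponential: there are at most 4^k monotone parent maps,
    against k^k arbitrary ones. *)
Definition codes k : {set code k} :=
  setX (setX [set t : k.-tuple 'I_k | sorted leq [seq val i | i <- t]] setT)
       [set X : {set 'I_k * 'I_k} | #|X| == excess].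

Definition shapes k : {set {ffun 'I_k -> {set 'I_k}}} :=
  [set B : {ffun 'I_k -> {set 'I_k}} | [&& [forall i, forall j in B i, (j < i)%N],
               (\sum_i #|B i| == (d * k).+1)%N &
               [exists c in codes k, coded B c]]].

(** Decoding follows the order of the vertices: the parent precedes i, so the back-neighbourhood
    into which the mask points is already known. *)
Lemma coded_inj k (B B' : {ffun 'I_k -> {set 'I_k}}) c :
  coded B c -> coded B' c -> B = B'.
Proof.
move=> /forallP Bc /forallP Bc'; apply/ffunP => i.
have [l] := ubnP (val i); elim: l i => // l IHl i il.
have := Bc i; have := Bc' i; case: ifP => [_ /eqP -> /eqP -> //|_ /=].
move=> /andP[ui /eqP ->] /andP[_ /eqP ->].
by rewrite IHl //; apply: leq_trans ui _.
Qed.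

(** The three factors count monotone parent maps, masks and sets of extra edges. *)
Lemma card_shapes k : (#|shapes k| <= 4 ^ k * 2 ^ (mask_size * k) * (k * k) ^ excess)%N.
Proof.
case: k => [|k].
  rewrite (_ : shapes 0 = set0) ?cards0 //; apply/setP => B.
  by rewrite !inE big_ord0 muln0 andbF.
pose f (B : {ffun 'I_k.+1 -> {set 'I_k.+1}}) :=
  [pick c | (c \in codes k.+1) && coded B c].
have fP B : B \in shapes k.+1 -> exists2 c, f B = Some c & (c \in codes k.+1) && coded B c.
  rewrite inE => /and3P[_ _ /exists_inP[c cc Bc]]; rewrite /f.
  case: pickP => [c' c'P|/(_ c)]; first by exists c'.
  by rewrite cc Bc.
rewrite -(card_in_imset (f := f)) => [|B B' /fP[c -> /andP[_ Bc]] /fP[c' -> /andP[_ Bc']] [e]].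
  apply: (@leq_trans #|Some @: codes k.+1|).
    apply: subset_leq_card; apply/subsetP => _ /imsetP[B /fP[c -> /andP[cc _]] ->].
    exact: imset_f.
  rewrite card_imset; last exact: Some_inj.
  rewrite !cardsX card_sorted_tuples cardsT card_ffun card_draws card_prod !card_ord.
  rewrite -cardsT -powersetT card_powerset cardsT card_ord -expnM.
  apply: leq_mul.
    apply: leq_mul => //; apply: (@leq_trans (2 ^ (k.+1 + k))).
      rewrite -[2%N]/(1 + 1)%N Pascal (bigD1 (inord k.+1 : 'I_(k.+1 + k).+1)) //=.
      by rewrite inordK ?ltnS ?leq_addr // !exp1n !muln1 leq_addr.
    by rewrite -[4%N]/(2 ^ 2)%N -expnM leq_exp2l //; lia.
  apply: leq_trans (_ : (k.+1 * k.+1) ^_ excess <= _)%N.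
    by rewrite -bin_ffact leq_pmulr // fact_gt0.
  by rewrite ffact_prod -[in leqRHS](card_ord excess) -prod_nat_const leq_prod // => i _; lia.
by rewrite e in Bc; exact: coded_inj Bc Bc'.
Qed.

End Shapes.

Lemma sum_square_sym (f : nat -> nat -> nat) N :
    (forall i j, f i j = f j i) -> (forall i, f i i = 0%N) ->
  (\sum_(0 <= i < N) \sum_(0 <= j < N) f i j)%N =
  ((\sum_(0 <= i < N) \sum_(0 <= j < i) f i j).*2)%N.
Proof.
move=> fC f0; elim: N => [|N IHN]; first by rewrite !big_geq.
rewrite !big_nat_recr //= doubleD -IHN f0 addn0.
under eq_bigr do rewrite big_nat_recr //=.
rewrite big_split /= -addnA -addnn; congr (_ + (_ + _))%N.
by apply: eq_bigr => i _.
Qed.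

(** The edges forced by a building order: those of the initial clique and d for each later vertex.
    What remains of the d k + 1 edges of a shape is exactly [excess]. *)
Lemma sum_minn d e :
  (\sum_(0 <= i < d.+1 + e) minn i d = 'C(d.+1, 2) + d * e)%N.
Proof.
elim: e => [|e IHe]; last first.
  by rewrite addnS big_nat_recr //= IHe mulnS (minn_idPr _) //; lia.
rewrite addn0 muln0 addn0 -bin2_sum big_nat [RHS]big_nat.
by apply: eq_bigr => i /andP[_ id]; apply/minn_idPl.
Qed.

Lemma card_ltn_ord m i : (i <= m)%N -> #|[set j : 'I_m | (j < i)%N]| = i.
Proof.
move=> im; rewrite -sum1_card; under eq_bigl do rewrite inE.
by rewrite -(big_ord_widen m (fun=> 1%N)) // sum1_card card_ord.
Qed.

Lemma set_between (T : finType) (A B : {set T}) q :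
  A \subset B -> (#|A| <= q <= #|B|)%N ->
  exists C : {set T}, [/\ A \subset C, C \subset B & #|C| = q].
Proof.
move=> AB /andP[Aq qB].
exists (A :|: [set x in take (q - #|A|) (enum (B :\: A))]); split.
- exact: subsetUl.
- rewrite subUset AB; apply/subsetP => x; rewrite inE => /mem_take.
  by rewrite mem_enum inE => /andP[].
rewrite cardsU (_ : A :&: _ = set0); last first.
  apply/setP => x; rewrite !inE; apply/negbTE/negP => /andP[xA /mem_take].
  by rewrite mem_enum inE xA.
rewrite cards0 subn0 cardsE (card_uniqP _) ?take_uniq ?enum_uniq //.
rewrite size_takel ?subnKC //.
by rewrite -cardE cardsD (setIidPr AB); lia.
Qed.

(** * Monotone building orders of dense tree-spanned sets *)

Section Greedy.
Variables (n : nat) (adj : rel 'I_n).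
Hypothesis adjC : symmetric adj.
Variables (d : nat) (V R : {set 'I_n}).
Hypothesis d_gt0 : (0 < d)%N.
Hypothesis VR : tree_spanned adj d V R.
Implicit Types (s : seq 'I_n) (v : 'I_n).

Definition attached s m v :=
  [exists t : {set 'I_n}, [&& t \subset take m s, #|t| == d & clique adj (v |: t)]].

(* Choosing the next vertex with the earliest possible attachment makes the
   attachment times monotone. *)
Lemma greedy_order j : (d.+1 + j <= #|V|)%N ->
  exists s (m : nat -> nat), [/\ size s = (d.+1 + j)%N, uniq s,
    {subset s <= V}, take d.+1 s =i R &
    forall i x0, (d < i < size s)%N ->
      [/\ (m i <= i)%N, attached s (m i) (nth x0 s i) &
        forall m' v, (m' < m i)%N -> v \in V -> v \notin take i s ->
          ~~ attached s m' v]].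
Proof.
have [RV Rd Rcl tree] := VR.
elim: j => [|j IHj] jV.
  exists (enum R), (fun=> 0%N); rewrite addn0 -cardE Rd enum_uniq; split=> //.
  - by move=> x; rewrite mem_enum; exact: subsetP.
  - by move=> x; rewrite take_oversize -?cardE ?Rd // mem_enum.
  - by move=> i x0; rewrite ltnS; case: ltngtP.
have [|s [m [ss us sV sR sm]]] := IHj; first by lia.
have sU : R \subset [set x in s].
  by apply/subsetP => x; rewrite -sR inE; exact: mem_take.
have sVU : [set x in s] \proper V.
  rewrite properEcard; apply/andP; split; first by apply/subsetP => x; rewrite inE; exact: sV.
  by rewrite cardsE (card_uniqP us) ss -addnS.
have ex : exists k, [exists v in V, (v \notin s) && attached s k v].
  have [v [t [vV tU td vt]]] := tree _ sU sVU.
  exists (size s); apply/exists_inP; exists v.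
    by move: vV; rewrite inE => /andP[].
  move: vV; rewrite !inE => /andP[-> _] /=; apply/existsP; exists t.
  rewrite take_size td eqxx vt /= andbT; apply/subsetP => x /(subsetP tU).
  by rewrite inE.
case: (ex_minnP ex) => k /exists_inP[v vV /andP[vs vk]] kmin.
have ks : (k <= size s)%N.
  apply: kmin; apply/exists_inP; exists v => //; rewrite vs /=.
  move/existsP: vk => [t /and3P[tk td vt]]; apply/existsP; exists t.
  rewrite td vt take_size !andbT; apply: subset_trans tk _.
  by apply/subsetP => x; exact: mem_take.
have tk l : (l <= size s)%N -> take l (rcons s v) = take l s.
  by move=> ls; rewrite -cats1 takel_cat.
have att l w : (l <= size s)%N -> attached (rcons s v) l w = attached s l w.
  by move=> ls; rewrite /attached tk.
exists (rcons s v), (fun i => if (i < size s)%N then m i else k).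
rewrite size_rcons rcons_uniq vs us ss addnS; split=> //.
- by move=> x; rewrite mem_rcons inE => /predU1P[->|/sV].
- by rewrite tk // ss leq_addr.
move=> i x0; rewrite -ss ltnS => /andP[di].
rewrite leq_eqVlt => /predU1P[->|iss].
  rewrite ltnn nth_rcons ltnn eqxx tk // take_size att //; split=> // m' w m'k wV ws.
  rewrite att; last by apply: leq_trans (ltnW m'k) ks.
  apply: contraTN m'k => aw; rewrite -leqNgt; apply: kmin.
  by apply/exists_inP; exists w => //; rewrite ws.
have [|mi ai mini] := sm i x0; first by rewrite di.
have mis : (m i <= size s)%N := leq_trans mi (ltnW iss).
rewrite iss nth_rcons iss tk ?(ltnW iss) // att //; split=> // m' w m'm wV ws.
by rewrite att ?mini // (leq_trans (ltnW m'm)).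
Qed.

(** Stop the order at the first prefix of k vertices with more than d k edges, and drop edges at its
    last vertex until d k + 1 remain. This exact count is what makes the number of edges outside the
    attaching cliques a constant. *)
Lemma dense_shape : (d.*2 * #|V| < \sum_(v in V) #|nbrs adj V v|)%N ->
  exists k (phi : {ffun 'I_k -> 'I_n}) (B : {ffun 'I_k -> {set 'I_k}}),
    [/\ injective phi, B \in shapes d k &
      forall i j, j \in B i -> adj (phi i) (phi j)].
Proof.
move=> dense; have [RV Rd Rcl _] := VR.
have dV : (d < #|V|)%N by rewrite -Rd; exact: subset_leq_card.
have [|s [m [ss us sV sR sm]]] := @greedy_order (#|V| - d.+1)%N.
  by rewrite subnKC.
rewrite subnKC // in ss.
have [x0 _] : exists x0, x0 \in R by apply/set0Pn; rewrite -card_gt0 Rd.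
set N := #|V| in ss dense dV.
pose x i := nth x0 s i.
have xV i : (i < N)%N -> x i \in V by move=> iN; apply/sV/mem_nth; rewrite ss.
have x_inj i j : (i < N)%N -> (j < N)%N -> (x i == x j) = (i == j).
  by move=> iN jN; rewrite nth_uniq ?ss.
have Vs : V = [set y in s].
  apply/esym/eqP; rewrite eqEcard cardsE (card_uniqP us) ss leqnn andbT.
  by apply/subsetP => y; rewrite inE; exact: sV.
pose b i := (\sum_(0 <= j < i) adj (x i) (x j))%N.
have sumb : (d * N < \sum_(0 <= i < N) b i)%N.
  suff e : (\sum_(v in V) #|nbrs adj V v| = (\sum_(0 <= i < N) b i).*2)%N.
    by move: dense; rewrite e -doubleMl ltn_double.
  pose f i j := ((x j != x i) && adj (x i) (x j) : nat).
  have sE (F : 'I_n -> nat) : (\sum_(v in V) F v = \sum_(0 <= i < N) F (x i))%N.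
    rewrite -ss -(big_nth x0 predT F) big_uniq //=.
    by apply: eq_bigl => v; rewrite Vs inE.
  have -> : (\sum_(0 <= i < N) b i = \sum_(0 <= i < N) \sum_(0 <= j < i) f i j)%N.
    rewrite big_nat [RHS]big_nat; apply: eq_bigr => i /andP[_ iN].
    rewrite /b big_nat [RHS]big_nat; apply: eq_bigr => j /andP[_ ji].
    by rewrite /f x_inj // ?(ltn_trans ji) // ltn_eqF.
  rewrite -sum_square_sym; last 2 first.
  - by move=> i j; rewrite /f eq_sym adjC.
  - by move=> i; rewrite /f eqxx.
  rewrite sE; apply: eq_bigr => i _.
  rewrite -(sE (fun u => (u != x i) && adj (x i) u : nat)) -sum1_card big_mkcond.
  rewrite [RHS]big_mkcond; apply: eq_bigr => u _; rewrite inE.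
  by case: (u \in V) => //=; case: (_ && _).
have : exists k, (d * k < \sum_(0 <= i < k) b i)%N by exists N.
move=> /ex_minnP[k' sumk kmin].
have kN : (k' <= N)%N by exact: kmin.
have bi i : (b i <= i)%N.
  apply: (@leq_trans (\sum_(0 <= j < i) 1)%N); last by rewrite sum_nat_const_nat muln1 subn0.
  by apply: leq_sum => j _; case: (adj _ _).
(* A vertex in position at most d has at most d earlier neighbours, so the prefix extends beyond the
   initial clique. *)
have dk : (d.+1 < k')%N.
  rewrite ltnNge; apply: contraTN sumk => kd; rewrite -leqNgt.
  apply: (@leq_trans (\sum_(0 <= j < k') d)%N); last by rewrite sum_nat_const_nat subn0 mulnC.
  rewrite big_nat [leqRHS]big_nat; apply: leq_sum => j /andP[_ jk].
  by apply: leq_trans (bi j) _; rewrite -ltnS (leq_trans jk).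
case: k' => // k in sumk kmin kN dk *; rewrite ltnS in dk.
have sumk' : (\sum_(0 <= i < k) b i <= d * k)%N.
  by rewrite leqNgt; apply/negP => /kmin; rewrite ltnn.
rewrite big_nat_recr //= mulnS in sumk.
have tex i : exists t : {set 'I_n}, (d < i < N)%N ->
    [/\ t \subset take (m i) s, #|t| = d & clique adj (x i |: t)].
  case: (boolP (d < i < N)%N) => [iN|_]; last by exists set0.
  have [|_ /existsP[t /and3P[tm /eqP td tc]] _] := sm i x0; first by rewrite ss.
  by exists t.
have [t tP] := choice tex.
have mi i : (d < i < N)%N -> (m i <= i)%N.
  by move=> iN; have [|->] := sm i x0; first by rewrite ss.
have in_tk i j : (j < N)%N -> (x j \in take i s) = (j < i)%N.
  by move=> jN; rewrite in_take ?index_uniq ?mem_nth ?ss.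
have mmin i m' j : (d < i < N)%N -> (m' < m i)%N -> (i <= j < N)%N -> ~~ attached s m' (x j).
  move=> iN mm /andP[ij jN]; have [|_ _ H] := sm i x0; first by rewrite ss.
  by apply: H => //; [exact: xV|rewrite in_tk // -leqNgt].
have mono i j : (d < i)%N -> (i <= j < N)%N -> (m i <= m j)%N.
  move=> di ij; have iN : (d < i < N)%N.
    by rewrite di; case/andP: ij; exact: leq_ltn_trans.
  have jN : (d < j < N)%N by case/andP: ij => /(leq_trans di) ->.
  rewrite leqNgt; apply/negP => mm; have /negP := mmin _ _ _ iN mm ij; apply.
  by apply/existsP; exists (t j); have [-> -> ->] := tP _ jN; rewrite eqxx.
have tm i y : (d < i < N)%N -> y \in t i -> exists2 j, (j < m i)%N & y = x j.
  move=> iN yt; have [/subsetP tk _ _] := tP _ iN; have yk := tk _ yt.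
  exists (index y s); last by rewrite /x nth_index ?(mem_take yk).
  by rewrite -in_take ?(mem_take yk).
(* The parent is the last vertex of the minimal prefix. It lies in the attaching clique, since
   otherwise a shorter prefix would do. *)
have parent i : (d < i < N)%N -> (0 < m i)%N /\ x (m i).-1 \in t i.
  move=> iN; have [tk td tc] := tP _ iN.
  have m0 : (0 < m i)%N.
    have /card_gt0P[y /(tm _ _ iN)[j jm _]] : (0 < #|t i|)%N by rewrite td.
    exact: leq_ltn_trans jm.
  split=> //; apply: contraT => nt.
  have /negP[] : ~~ attached s (m i).-1 (x i).
    by apply: (mmin i); rewrite ?prednK // leqnn; case/andP: iN.
  apply/existsP; exists (t i); rewrite td tc eqxx !andbT.
  apply/subsetP => y yt; have [j jm yE] := tm _ _ iN yt.
  have jN : (j < N)%N by apply: leq_trans jm (leq_trans (mi _ iN) (ltnW _)); case/andP: iN.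
  rewrite yE in_tk // ltn_neqAle -ltnS prednK // jm andbT.
  by apply: contraNneq nt => <-; rewrite -yE.
have ltN (i : 'I_k.+1) : (i < N)%N by exact: leq_trans kN.
pose FF (i : 'I_k.+1) := [set j : 'I_k.+1 | (j < i)%N & adj (x i) (x j)].
pose TT (i : 'I_k.+1) := [set j : 'I_k.+1 | x j \in t i].
have cardFF i : #|FF i| = b i.
  rewrite /b big_mkord (big_ord_widen k.+1 (fun j => adj (x i) (x j) : nat)); last exact: ltnW.
  rewrite -sum1_card big_mkcond [RHS]big_mkcond; apply: eq_bigr => j _.
  by rewrite inE; case: (j < i)%N => //=; case: (adj _ _).
have TTm (i j : 'I_k.+1) : (d < i)%N -> j \in TT i -> (j < m i)%N.
  move=> di; rewrite inE => /(tm i)[|l lm]; first by rewrite di ltN.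
  move/eqP; rewrite x_inj // => [/eqP ->//|].
  by apply: leq_trans lm _; apply: leq_trans (mi _ _) (ltnW (ltN i)); rewrite di ltN.
have TTF (i : 'I_k.+1) : (d < i)%N -> TT i \subset FF i.
  move=> di; have iN : (d < i < N)%N by rewrite di ltN.
  apply/subsetP => j jT; have ji : (j < i)%N := leq_trans (TTm _ _ di jT) (mi _ iN).
  rewrite inE ji /=; have [_ _ /cliqueP tc] := tP _ iN; apply: tc.
  - exact: setU11.
  - by apply/setU1P; right; move: jT; rewrite inE.
  - by rewrite x_inj // gtn_eqF.
have cardTT (i : 'I_k.+1) : (d < i)%N -> #|TT i| = d.
  move=> di; have iN : (d < i < N)%N by rewrite di ltN.
  have [_ <- _] := tP _ iN.
  rewrite -(card_in_imset (f := fun j : 'I_k.+1 => x j) (D := TT i)); last first.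
    by move=> a c _ _ /eqP; rewrite x_inj // => /eqP /val_inj.
  apply: eq_card => y; apply/imsetP/idP => [[j jT ->]|yt].
    by move: jT; rewrite inE.
  have [j jm yE] := tm _ _ iN yt.
  have jk : (j < k.+1)%N by apply: leq_trans jm (leq_trans (mi _ iN) (ltnW _)).
  by exists (Ordinal jk); rewrite ?inE -?yE.
(* Only the last vertex is trimmed, and it keeps its attaching clique: the previous prefix has at
   most d k edges, so at least d + 1 of the required edges must end at the last vertex. *)
have [A [TA AF Aq]] : exists A : {set 'I_k.+1}, [/\ TT ord_max \subset A, A \subset FF ord_max &
    #|A| = ((d * k.+1).+1 - \sum_(0 <= i < k) b i)%N].
  apply: set_between; first by apply: TTF.
  rewrite cardTT // cardFF /= mulnS; move: sumk sumk'; clear.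
  by set S := (\sum_(0 <= i < k) b i)%N; lia.
pose B := [ffun i : 'I_k.+1 => if i == ord_max then A else FF i].
have BF (i : 'I_k.+1) : B i \subset FF i by rewrite ffunE; case: eqP => [->|].
have Bfull (i : 'I_k.+1) : (i < k)%N -> B i = FF i.
  by move=> ik; rewrite ffunE; case: eqP ik => // ->; rewrite ltnn.
have TB (i : 'I_k.+1) : (d < i)%N -> TT i \subset B i.
  by move=> di; rewrite ffunE; case: eqP => [->|_] //; exact: TTF.
have sumB : (\sum_i #|B i| = (d * k.+1).+1)%N.
  rewrite big_ord_recr /= [B ord_max]ffunE eqxx Aq.
  rewrite (eq_bigr (fun i : 'I_k => b i)) => [|i _].
    rewrite big_mkord in sumk' *; rewrite subnKC //.
    by apply: leq_trans sumk' _; rewrite mulnS; lia.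
  by rewrite Bfull ?cardFF //=.
have Binit (i : 'I_k.+1) : (i <= d)%N -> B i = [set j : 'I_k.+1 | (j < i)%N].
  move=> id; rewrite Bfull ?(leq_ltn_trans id) //; apply/setP => j; rewrite !inE.
  case: (boolP (j < i)%N) => //= ji.
  move/cliqueP: Rcl; apply; rewrite -?sR ?in_tk ?ltnS ?x_inj ?ltN //.
    by apply: leq_trans (ltnW ji) id.
  by rewrite gtn_eqF.
pose X := [set a : 'I_k.+1 * 'I_k.+1 | (d < a.1)%N & a.2 \in B a.1 :\: TT a.1].
have cardX : #|X| = excess d.
  have XE : #|X| = (\sum_(i : 'I_k.+1 | (d < i)%N) #|B i :\: TT i|)%N.
    rewrite -sum1_card (eq_bigr (fun i => \sum_(j in B i :\: TT i) 1)%N) => [|i _].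
      rewrite pair_big_dep; apply: eq_bigl => -[i j]; by rewrite [LHS]inE.
    by rewrite sum1_card.
  have : (\sum_(i < k.+1) #|B i| = \sum_(i < k.+1) minn i d + #|X|)%N.
    rewrite XE [X in (_ + X)%N]big_mkcond -big_split; apply: eq_bigr => i _ /=.
    case: (leqP i d) => id; last first.
      rewrite cardsD (setIidPr (TB _ id)) cardTT // subnKC // -(cardTT i) //.
      by rewrite subset_leq_card // TB.
    by rewrite Binit // addn0 card_ltn_ord // ltnW.
  rewrite sumB -(big_mkord predT (fun i => minn i d)).
  clear -dk; move: #|X| => q; have -> : k.+1 = (d.+1 + (k - d))%N by rewrite addSn subnKC // ltnW.
  rewrite sum_minn /excess mulnDr mulnS.
  have := bin_ffact d.+1 2; rewrite ffactnS ffactn1 /= (_ : 2`! = 2)%N //.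
  by lia.
have cardB (i : 'I_k.+1) : (#|B i| <= mask_size d)%N.
  case: (leqP i d) => id.
    apply: (leq_trans (subset_leq_card (BF i))); rewrite cardFF.
    by apply: leq_trans (bi i) _; apply: leq_trans id (leq_addr _ _).
  rewrite -(cardsID (TT i)) leq_add //.
    by rewrite -[leqRHS](cardTT i) // subset_leq_card // subsetIr.
  rewrite -cardX -(card_imset (B i :\: TT i) (f := pair i)); last by move=> a c [].
  apply: subset_leq_card; apply/subsetP => _ /imsetP[j jB ->].
  by rewrite inE /= id.
(* The default 0 on the initial clique keeps the parent map monotone. Positions start at 0, so the
   prefix of length [m i] ends at [(m i).-1]. *)
pose par (i : 'I_k.+1) : 'I_k.+1 := if (i <= d)%N then ord0 else inord (m i).-1.
pose mask := [ffun i : 'I_k.+1 => [set a : 'I_(mask_size d) |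
  [exists j in TT i :\ par i, val a == index j (enum (B (par i)))]]].
have parE (i : 'I_k.+1) : (d < i)%N -> par i = (m i).-1 :> nat.
  move=> di; rewrite /par leqNgt di inordK // ltnS.
  apply: leq_trans (leq_pred _) _; apply: leq_trans (mi _ _) _; first by rewrite di ltN.
  by rewrite -ltnS.
exists k.+1, [ffun i : 'I_k.+1 => x i], B; split.
- by move=> i j; rewrite !ffunE => /eqP; rewrite x_inj // => /eqP /val_inj.
- rewrite inE sumB eqxx /=; apply/andP; split.
    apply/forallP => i; apply/forall_inP => j /(subsetP (BF i)).
    by rewrite inE => /andP[].
  apply/exists_inP; exists ([tuple par i | i < k.+1], mask, X).
    rewrite !inE cardX eqxx !andbT /= sorted_map.
    apply: (homo_sorted_in (P := predT) (e := relpre val leq)); last 2 first.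
    - by apply/allP.
    - by rewrite -sorted_map val_enum_ord iota_sorted.
    move=> i j _ _ /= ij; case: (leqP i d) => id; first by rewrite {1}/par id.
    have jd : (d < j)%N by exact: leq_trans ij.
    rewrite !parE // -!subn1 leq_sub2r // mono //.
    by rewrite ij ltN.
  apply/forallP => i; case: ifP => [id|/negbT]; first by rewrite Binit.
  rewrite -ltnNge => di; have iN : (d < i < N)%N by rewrite di ltN.
  rewrite /= tnth_mktuple; have [m0 xp] := parent _ iN.
  have pT : par i \in TT i by rewrite inE parE.
  have pi : (par i < i)%N by rewrite parE // prednK // mi.
  have pk : (par i < k)%N by apply: leq_trans pi _; rewrite -ltnS.
  (* The rest of the attaching clique is adjacent to the parent and precedes it. As the parent is
     not the trimmed last vertex, its back-neighbourhood is complete. *)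
  have TpB j : j \in TT i -> j != par i -> j \in B (par i).
    move=> jT jp; rewrite Bfull // inE ltn_neqAle jp parE //.
    rewrite -ltnS prednK // TTm //= -parE //.
    have [_ _ /cliqueP tc] := tP _ iN; apply: tc; rewrite ?inE.
    - by move: pT; rewrite inE => ->; rewrite orbT.
    - by move: jT; rewrite inE => ->; rewrite orbT.
    by rewrite x_inj // eq_sym.
  rewrite pi /=; apply/eqP/setP => j; apply/idP/setUP => [jB|[/setU1P[->|]|]].
  - case: (boolP (j \in TT i)) => jT; last by right; rewrite inE inE /= di inE jT.
    case: (eqVneq j (par i)) => [->|jp]; left; first exact: setU11.
    apply/setU1P; right; have jBp := TpB _ jT jp; rewrite inE jBp /=.
    have ij : (index j (enum (B (par i))) < mask_size d)%N.
      by apply: leq_trans (cardB (par i)); rewrite cardE index_mem mem_enum.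
    apply/exists_inP; exists (Ordinal ij) => //.
    rewrite [mask _]ffunE inE; apply/exists_inP; exists j => //.
    by rewrite !inE jp; move: jT; rewrite inE.
  - exact: (subsetP (TB _ di)).
  - rewrite inE => /andP[jBp /exists_inP[a]]; rewrite [mask _]ffunE inE.
    move=> /exists_inP[j' /setD1P[j'p j'T] /eqP ->] /eqP e.
    have j'B := TpB _ j'T j'p.
    have -> : j = j'.
      rewrite -(nth_index j (s := enum (B (par i))) (x := j)) ?mem_enum // -e.
      by rewrite nth_index ?mem_enum.
    exact: (subsetP (TB _ di)).
  - by rewrite inE /= inE /= => /andP[_ /setDP[]].
- by move=> i j /(subsetP (BF i)); rewrite inE !ffunE => /andP[].
Qed.

End Greedy.

(** * The measure of G(n,p) *)

Section Expectation.
Variables (R : realType) (n : nat) (p : R).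
Hypothesis p01 : 0 <= p <= 1.
Implicit Types (S : {set edge n}) (G : graph n) (f g : graph n -> R).

Definition gnp_mean f := \sum_(G : graph n) gnp_pmf p G * f G.
Definition gnp_pr (A : pred (graph n)) := gnp_mean (fun G => (A G)%:R).

Lemma gnp_mean_le f g : (forall G, f G <= g G) -> gnp_mean f <= gnp_mean g.
Proof. by move=> fg; apply: ler_sum => G _; rewrite ler_wpM2l // gnp_pmf_ge0. Qed.

Lemma eq_gnp_mean f g : f =1 g -> gnp_mean f = gnp_mean g.
Proof. by move=> fg; apply: eq_bigr => G _; rewrite fg. Qed.

Lemma gnp_meanD f g : gnp_mean (fun G => f G + g G) = gnp_mean f + gnp_mean g.
Proof. by rewrite /gnp_mean -big_split; apply: eq_bigr => G _; rewrite mulrDr. Qed.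

Lemma gnp_meanB f g : gnp_mean (fun G => f G - g G) = gnp_mean f - gnp_mean g.
Proof. by rewrite /gnp_mean -sumrB; apply: eq_bigr => G _; rewrite mulrBr. Qed.

Lemma gnp_meanZ a f : gnp_mean (fun G => a * f G) = a * gnp_mean f.
Proof. by rewrite /gnp_mean mulr_sumr; apply: eq_bigr => G _; rewrite mulrCA. Qed.

Lemma gnp_mean_sum (I : finType) (P : pred I) (f : I -> graph n -> R) :
  gnp_mean (fun G => \sum_(i | P i) f i G) = \sum_(i | P i) gnp_mean (f i).
Proof. by rewrite /gnp_mean exchange_big /=; apply: eq_bigr => G _; rewrite mulr_sumr. Qed.

Lemma gnp_mean_norm f : `|gnp_mean f| <= gnp_mean (fun G => `|f G|).
Proof.
apply: le_trans (ler_norm_sum _ _ _) _; apply: ler_sum => G _.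
by rewrite normrM ger0_norm // gnp_pmf_ge0.
Qed.

Lemma gnp_mean_cst a : gnp_mean (fun=> a) = a.
Proof. by rewrite /gnp_mean -mulr_suml gnp_pmf1 mul1r. Qed.

Lemma gnp_pr_ge0 A : 0 <= gnp_pr A.
Proof. by apply: sumr_ge0 => G _; rewrite mulr_ge0 ?gnp_pmf_ge0. Qed.

Lemma gnp_pr_le1 A : gnp_pr A <= 1.
Proof.
rewrite -(gnp_mean_cst 1); apply: gnp_mean_le => G.
by rewrite lern1; case: (A G).
Qed.

(** Pair each graph without e with the one obtained by adding e: the other edges weigh the same in
    both, and the weights p and 1 - p of e add up to 1. *)
Lemma gnp_mean_edge (e : edge n) f :
  gnp_mean (fun G => (e \in G)%:R * f G) = p * gnp_mean (fun G => f (e |: G)).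
Proof.
pose w (G : graph n) : R := \prod_(e' | e' != e) bernoulli_pmf p (e' \in G).
have wE G : gnp_pmf p G = bernoulli_pmf p (e \in G) * w G.
  by rewrite /gnp_pmf (bigD1 e).
have wU G : w (e |: G) = w G.
  by apply: eq_bigr => e' ne; rewrite !inE (negPf ne).
have -> : gnp_mean (fun G => f (e |: G)) = \sum_(G : graph n | e \in G) w G * f G.
  rewrite /gnp_mean (bigID (fun G : graph n => e \in G)) /= addrC.
  have -> : \sum_(G : graph n | e \notin G) gnp_pmf p G * f (e |: G) =
            (1 - p) * \sum_(G : graph n | e \in G) w G * f G.
    rewrite mulr_sumr [RHS](reindex_onto (fun G => e |: G) (fun G => G :\ e)) /=.
      apply: eq_big => [G|G eG]; last by rewrite wE (negPf eG) wU mulrA.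
      rewrite setU11 /=; apply/idP/eqP => [/setU1K //|<-].
      by rewrite setD11.
    by move=> G eG; rewrite setD1K.
  rewrite mulr_sumr -big_split /=; apply: eq_bigr => G eG.
  by rewrite wE eG /= (setUidPr _) ?sub1set //; ring.
rewrite /gnp_mean (bigID (fun G : graph n => e \in G)) /= addrC big1 ?add0r.
  by rewrite mulr_sumr; apply: eq_bigr => G eG; rewrite wE eG /=; ring.
by move=> G /negPf ->; rewrite mul0r mulr0.
Qed.

(** Conditioned on containing S, the random graph is distributed as G with S added; this is the
    coupling behind the size bias. *)
Lemma gnp_mean_subset S f :
  gnp_mean (fun G => (S \subset G)%:R * f G) =
  p ^+ #|S| * gnp_mean (fun G => f (G :|: S)).
Proof.
have [k] := ubnP #|S|; elim: k S f => // k IHk S f Sk.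
have [->|[e eS]] := set_0Vmem S.
  by rewrite cards0 expr0 mul1r; apply: eq_gnp_mean => G; rewrite sub0set setU0 mul1r.
have cS : #|S| = #|S :\ e|.+1 by rewrite (cardsD1 e) eS.
have step G : (S \subset G)%:R * f G = (e \in G)%:R * ((S :\ e \subset G)%:R * f G).
  by rewrite mulrA -natrM mulnb -sub1set -subUset setD1K.
rewrite (eq_gnp_mean step) gnp_mean_edge cS exprS -mulrA; congr (_ * _).
have sub G : (S :\ e \subset e |: G) = (S :\ e \subset G).
  by rewrite -subDset setDDl setUid.
rewrite (eq_gnp_mean (g := fun G => (S :\ e \subset G)%:R * f (e |: G))); last first.
  by move=> G; rewrite sub.
rewrite IHk; last by rewrite -ltnS -cS.
congr (_ * _); apply: eq_gnp_mean => G; by rewrite setUCA setD1K.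
Qed.

Lemma gnp_pr_subset S : gnp_pr (fun G => S \subset G) = p ^+ #|S|.
Proof.
rewrite -[RHS]mulr1 -[X in _ * X](gnp_mean_cst 1) -(gnp_mean_subset S (fun=> 1)).
by apply: eq_gnp_mean => G; rewrite mulr1.
Qed.

Lemma gnp_pr_subsetU S T : gnp_pr (fun G => S \subset G :|: T) = p ^+ #|S :\: T|.
Proof.
rewrite -gnp_pr_subset; apply: eq_gnp_mean => G.
by rewrite setUC -subDset.
Qed.

Lemma gnp_pr_union (I : finType) (P : pred I) (S : I -> {set edge n}) (A : pred (graph n)) :
    (forall G, A G -> exists2 i, P i & S i \subset G) ->
  gnp_pr A <= \sum_(i | P i) p ^+ #|S i|.
Proof.
move=> AP; under eq_bigr do rewrite -gnp_pr_subset.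
rewrite -gnp_mean_sum; apply: gnp_mean_le => G.
case: (boolP (A G)) => [/AP[i Pi SG]|_]; last by apply: sumr_ge0 => i _; rewrite ler0n.
by rewrite (bigD1 i) //= SG lerDl; apply: sumr_ge0 => j _; rewrite ler0n.
Qed.

End Expectation.

Arguments eq_gnp_mean {R n p f g}.

(** * The number of cross-polytopes *)

Section Crosses.
Variable n : nat.
Implicit Types (U V : {set 'I_n}) (P Q E : {set edge n}) (e : edge n).

Lemma edge_exists (u v : 'I_n) : u != v -> exists e : edge n, val e = [set u; v].
Proof.
move=> uv; have h : #|[set u; v]| == 2%N by rewrite cards2 uv.
by exists (exist _ [set u; v] h).
Qed.

Lemma card_edge e : #|val e| = 2%N.
Proof. exact/eqP/(valP e). Qed.

Definition edges_in V : {set edge n} := [set e : edge n | val e \subset V].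

Definition vertices P := \bigcup_(e in P) val e.

Definition matching m P := (#|P| == m) &&
  [forall e in P, forall e' in P, (e != e') ==> [disjoint val e & val e']].

(* A cross-polytope is encoded by the set of its antipodal pairs. *)
Definition crosses d : {set {set edge n}} := [set P | matching d.+1 P].

Definition cross_edges P : {set edge n} := edges_in (vertices P) :\: P.

Lemma matchingP m P : reflect (#|P| = m /\
   {in P &, forall e e', e != e' -> [disjoint val e & val e']}) (matching m P).
Proof.
apply: (iffP andP) => [[/eqP Pc /forall_inP H]|[Pc H]]; split.
- exact: Pc.
- by move=> e e' eP e'P; have /forall_inP/(_ e' e'P)/implyP := H e eP.
- exact/eqP.
- by apply/forall_inP => e eP; apply/forall_inP => e' e'P; apply/implyP/H.
Qed.

Lemma matching_eq m P e e' (v : 'I_n) : matching m P -> e \in P -> e' \in P ->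
  v \in val e -> v \in val e' -> e = e'.
Proof.
move=> /matchingP[_ H] eP e'P ve ve'; apply/eqP; apply: contraT => ne.
by have := H _ _ eP e'P ne; rewrite -setI_eq0 => /eqP/setP/(_ v); rewrite !inE ve ve'.
Qed.

Lemma in_vertices P e v : e \in P -> v \in val e -> v \in vertices P.
Proof. by move=> eP ve; apply/bigcupP; exists e. Qed.

Lemma sub_edges_in P V : (P \subset edges_in V) = (vertices P \subset V).
Proof.
apply/subsetP/subsetP => [PV v /bigcupP[e eP ve]|PV e eP].
  by have := PV _ eP; rewrite inE => /subsetP; apply.
by rewrite inE; apply/subsetP => v ve; apply/PV/in_vertices/ve.
Qed.

Lemma card_vertices m P : matching m P -> #|vertices P| = m.*2.
Proof.
move=> Pm; have [Pc Pd] := matchingP _ _ Pm.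
have -> : vertices P = cover (val @: P).
  by rewrite cover_imset.
have /eqP <- : trivIset (val @: P).
  apply/trivIsetP => _ _ /imsetP[e eP ->] /imsetP[e' e'P ->] ne.
  by apply: Pd => //; apply: contraNneq ne => ->.
rewrite big_imset /=; last by move=> e e' _ _; exact: val_inj.
by under eq_bigr do rewrite card_edge; rewrite sum_nat_const Pc muln2.
Qed.

Lemma card_edges_in V : #|edges_in V| = 'C(#|V|, 2).
Proof.
rewrite -cards_draws -(card_imset (edges_in V) (f := val)); last exact: val_inj.
apply: eq_card => s; rewrite inE; apply/imsetP/andP => [[e eV ->]|[sV s2]].
  by move: eV; rewrite inE card_edge eqxx => ->.
by exists (exist _ s s2) => //; rewrite inE.
Qed.

Lemma card_cross_edges d P : matching d.+1 P -> #|cross_edges P| = (2 * (d + 1) * d)%N.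
Proof.
move=> Pm; have [Pc _] := matchingP _ _ Pm.
rewrite cardsD (setIidPr _) ?sub_edges_in // card_edges_in (card_vertices Pm) Pc.
have := bin_ffact d.+1.*2 2; rewrite (_ : 2`! = 2)%N // !ffactnS ffactn0 /=.
by rewrite doubleS /=; nia.
Qed.

Definition deg E (v : 'I_n) := #|[set e in E | v \in val e]|.

Lemma handshake E V : E \subset edges_in V -> (\sum_(v in V) deg E v = #|E|.*2)%N.
Proof.
move=> /subsetP EV; rewrite /deg.
under eq_bigr do rewrite -sum1dep_card.
rewrite (exchange_big_dep (fun e => e \in E)) /=; last by move=> v e _ /andP[].
rewrite -muln2 -sum_nat_const; apply: eq_bigr => e eE.
transitivity #|val e|; last exact: card_edge.
rewrite -sum1_card; apply: eq_bigl => v; rewrite eE /=.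
by apply: andb_idl => ve; have := EV _ eE; rewrite inE => /subsetP; apply.
Qed.

Lemma deg_edges_in V v : v \in V -> (deg (edges_in V) v).+1 = #|V|.
Proof.
move=> vV; rewrite [RHS](cardsD1 v) vV add1n; congr _.+1.
rewrite -(card_imset (V :\ v) (f := set1)); last exact: set1_inj.
rewrite /deg -(card_in_imset (f := fun e : edge n => val e :\ v)); last first.
  move=> e e'; rewrite !inE => /andP[_ ve] /andP[_ ve'] eq.
  by apply: val_inj; rewrite -(setD1K ve) -(setD1K ve') eq.
apply: eq_card => s; apply/imsetP/imsetP => [[e]|[u]].
  rewrite !inE => /andP[eV ve] ->.
  have /eqP/cards1P[u uE] : #|val e :\ v| = 1%N.
    by have := card_edge e; rewrite (cardsD1 v) ve => -[].
  exists u => //; have : u \in val e :\ v by rewrite uE set11.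
  by rewrite !inE => /andP[-> /(subsetP eV) ->].
rewrite !inE => /andP[uv uV] ->; have [e eE] := edge_exists uv.
exists e; rewrite ?inE eE.
  by rewrite set22 subUset !sub1set uV vV.
apply/setP => x; rewrite !inE; case: (eqVneq x v) => [->|] /=; rewrite ?orbF //.
by rewrite eq_sym (negPf uv).
Qed.

Lemma deg_matching m P v : matching m P -> v \in vertices P -> deg P v = 1%N.
Proof.
move=> Pm /bigcupP[e eP ve]; rewrite -(cards1 e); apply: eq_card => e'.
rewrite !inE; apply/andP/eqP => [[e'P ve']|->//].
exact: matching_eq Pm _ _ ve' ve.
Qed.

Lemma deg_cross d P v : matching d.+1 P -> v \in vertices P ->
  deg (cross_edges P) v = d.*2.
Proof.
move=> Pm vP; have PV : P \subset edges_in (vertices P) by rewrite sub_edges_in.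
suff : (deg (cross_edges P) v + deg P v = deg (edges_in (vertices P)) v)%N.
  rewrite (deg_matching Pm vP); have := deg_edges_in vP.
  by rewrite (card_vertices Pm) doubleS; lia.
rewrite addnC /deg -(cardsID P [set e in edges_in _ | _]); congr (_ + _)%N.
  apply: eq_card => e; rewrite !inE; case: (boolP (e \in P)) => eP; rewrite ?andbF //=.
  by rewrite andbT; have := subsetP PV _ eP; rewrite inE => ->.
by apply: eq_card => e; rewrite !inE; case: (e \in P); case: (v \in _); rewrite ?andbF ?andbT.
Qed.

Lemma deg_mono E E' v : E \subset E' -> (deg E v <= deg E' v)%N.
Proof.
move=> /subsetP EE; apply: subset_leq_card; apply/subsetP => e.
by rewrite !inE => /andP[/EE -> ->].
Qed.

Lemma cross_edges_inj d P Q : matching d.+1 P -> matching d.+1 Q ->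
  vertices P = vertices Q -> cross_edges P = cross_edges Q -> P = Q.
Proof.
move=> Pm Qm VPQ EPQ.
have E (X : {set edge n}) : X = edges_in (vertices X) :\: cross_edges X.
  rewrite /cross_edges setDDr setDv set0U; apply/esym/setIidPr.
  by rewrite sub_edges_in.
by rewrite (E P) (E Q) VPQ EPQ.
Qed.

(** All degrees in the union are at least 2d, so one vertex of larger degree suffices: a vertex of P
    on an edge of Q that P lacks. If there were none, a vertex of Q outside P would have both ends
    of a common edge as antipodes; so both have the same vertices, and then the same edges. *)
Lemma cross_overlap d P Q : matching d.+1 P -> matching d.+1 Q -> P != Q ->
    cross_edges P :&: cross_edges Q != set0 ->
  (d * #|vertices P :|: vertices Q| < #|cross_edges P :|: cross_edges Q|)%N.
Proof.
move=> Pm Qm PQ /set0Pn[f /setIP[fP fQ]].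
set V := _ :|: vertices Q; set E := _ :|: cross_edges Q.
have EV : E \subset edges_in V.
  rewrite subUset; apply/andP; split; apply: subset_trans (subsetDl _ _) _;
    apply/subsetP => e; rewrite !inE => eV; apply: subset_trans eV _;
    by rewrite ?subsetUl ?subsetUr.
have vin (X : {set edge n}) e v : e \in cross_edges X -> v \in val e -> v \in vertices X.
  by rewrite inE => /andP[_]; rewrite inE => /subsetP; apply.
have dP v : v \in vertices P -> (d.*2 <= deg E v)%N.
  by move=> vP; rewrite -(deg_cross Pm vP) deg_mono // subsetUl.
have dQ v : v \in vertices Q -> (d.*2 <= deg E v)%N.
  by move=> vQ; rewrite -(deg_cross Qm vQ) deg_mono // subsetUr.
have [e [v [eQ eP ve vP]]] : exists e v,
    [/\ e \in cross_edges Q, e \notin cross_edges P, v \in val e & v \in vertices P].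
  apply: contrapT => H.
  have HP e v : e \in cross_edges Q -> v \in val e -> v \in vertices P -> e \in cross_edges P.
    by move=> eQ ve vP; apply: contraT => eP; exfalso; apply: H; exists e, v.
  have /cards2P[x [y [xy fE]]] := valP f.
  have xf : x \in val f by rewrite fE set21.
  have yf : y \in val f by rewrite fE set22.
  have QP : vertices Q \subset vertices P.
    apply/subsetP => u uQ; apply: contraT => uP.
    have ne z : z \in val f -> u != z.
      by move=> zf; apply: contraNneq uP => ->; exact: vin fP zf.
    have [ex exE] := edge_exists (ne _ xf); have [ey eyE] := edge_exists (ne _ yf).
    have exy : ex != ey.
      apply/eqP => /(congr1 val) exy; have : x \in val ey by rewrite -exy exE set22.
      rewrite eyE !inE (negPf xy) orbF => /eqP xu; have := ne _ xf.
      by rewrite xu eqxx.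
    have cl z ez : val ez = [set u; z] -> z \in val f -> ez \notin Q -> False.
      move=> ezE zf ezQ; have ezc : ez \in cross_edges Q.
        by rewrite !inE ezQ ezE subUset !sub1set uQ (vin _ _ _ fQ zf).
      have := HP _ z ezc; rewrite ezE set22 (vin _ _ _ fP zf) => /(_ isT isT).
      by move=> ezP; have := vin _ _ u ezP; rewrite ezE set21 => /(_ isT); rewrite (negPf uP).
    case: (boolP (ex \in Q)) => [exQ|/(cl _ _ exE xf)//].
    case: (boolP (ey \in Q)) => [eyQ|/(cl _ _ eyE yf)//].
    case/eqP: exy; apply: (matching_eq Qm exQ eyQ (v := u)).
      by rewrite exE set21.
    by rewrite eyE set21.
  have VPQ : vertices P = vertices Q.
    by apply/eqP; rewrite eq_sym eqEcard QP (card_vertices Pm) (card_vertices Qm) leqnn.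
  have /negP[] := PQ; apply/eqP; apply: (cross_edges_inj Pm Qm VPQ).
  apply/eqP; rewrite eq_sym eqEcard (card_cross_edges Pm) (card_cross_edges Qm) leqnn andbT.
  apply/subsetP => e eQ; have /card_gt0P[v ve] : (0 < #|val e|)%N by rewrite card_edge.
  by apply: (HP e v) => //; rewrite VPQ; exact: (vin _ _ _ eQ ve).
have vV : v \in V by rewrite inE vP.
have dv : (d.*2 < deg E v)%N.
  rewrite -(deg_cross Pm vP) /deg; apply: proper_card; apply/properP; split.
    apply/subsetP => e'; rewrite in_set => /andP[e'P ve']; rewrite in_set ve' andbT.
    by apply/setUP; left.
  exists e; first by rewrite in_set ve andbT; apply/setUP; right.
  by rewrite in_set (negPf eP).
rewrite -ltn_double -(handshake EV) (bigD1 v) //= (cardsD1 v V) vV doubleMl mulnDr muln1 -addSn.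
apply: leq_add => //.
have -> : #|V :\ v| = #|[pred u in V | u != v]|.
  by apply: eq_card => u; rewrite !inE andbC.
rewrite mulnC -sum_nat_const; apply: leq_sum => u /andP[].
by rewrite inE => /orP[/dP|/dQ].
Qed.

(** Ordering the m pairs and each pair internally lists 2m distinct vertices. The induction counts
    in two ways the matchings with a marked edge, whose removal leaves a matching on the other
    vertices of U. *)
Lemma card_matchings m U :
  (#|[set P | matching m P & P \subset edges_in U]| * (m`! * 2 ^ m) = #|U| ^_ m.*2)%N.
Proof.
elim: m U => [|m IHm] U.
  rewrite (_ : [set P | _ & _] = [set set0]) ?cards1 //; apply/setP => P.
  rewrite !inE; apply/andP/eqP => [[/matchingP[/eqP]]|->].
    by rewrite cards_eq0 => /eqP.
  by rewrite sub0set; split=> //; apply/matchingP; split=> [|e]; rewrite ?cards0 // inE.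
set M := [set P | _ & _].
have count : (#|M| * m.+1 = \sum_(e in edges_in U)
    #|[set P | matching m P & P \subset edges_in (U :\: val e)]|)%N.
  rewrite -sum_nat_const.
  transitivity (\sum_(P in M) \sum_(e in edges_in U | e \in P) 1)%N.
    apply: eq_bigr => P; rewrite inE => /andP[/matchingP[<- _] /subsetP PU].
    by rewrite -sum1_card; apply: eq_bigl => e; rewrite andbC andb_idr //; apply: PU.
  rewrite (exchange_big_dep (fun e => e \in edges_in U)) /=; last by move=> P e _ /andP[].
  apply: eq_bigr => e eU; have eU' : val e \subset U by move: eU; rewrite inE.
  have eN Q : Q \subset edges_in (U :\: val e) -> e \notin Q.
    move=> /subsetP QU; apply/negP => /QU; rewrite inE subsetD => /andP[_].
    by rewrite -setI_eq0 setIid -cards_eq0 card_edge.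
  rewrite sum1dep_card -(card_in_imset (f := fun P => e |: P)
     (D := [set P | matching m P & P \subset edges_in (U :\: val e)])); last first.
    move=> P Q; rewrite !inE => /andP[_ /eN eP] /andP[_ /eN eQ] PQ.
    by rewrite -(setU1K eP) -(setU1K eQ) PQ.
  apply: eq_card => P; rewrite !inE eU' /=; apply/andP/imsetP => [[/andP[Pm PU] eP]|[Q]].
    have [Pc Pd] := matchingP _ _ Pm.
    exists (P :\ e); last by rewrite setD1K.
    rewrite inE; apply/andP; split.
      apply/matchingP; split; first by move: Pc; rewrite (cardsD1 e) eP => -[].
      by move=> f g /setD1P[_ fP] /setD1P[_ gP]; exact: Pd.
    apply/subsetP => f /setD1P[fe fP]; rewrite inE subsetD Pd // andbT.
    by have := subsetP PU _ fP; rewrite inE.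
  rewrite inE => /andP[Qm QU] ->; have [Qc Qd] := matchingP _ _ Qm.
  have dis f : f \in Q -> [disjoint val f & val e].
    by move=> /(subsetP QU); rewrite inE subsetD => /andP[].
  split; last exact: setU11.
  apply/andP; split.
    apply/matchingP; split; first by rewrite cardsU1 (eN _ QU) Qc.
    move=> f g /setU1P[->|fQ] /setU1P[->|gQ]; rewrite ?eqxx // => fg.
    - by rewrite disjoint_sym dis.
    - exact: dis.
    - exact: Qd.
  rewrite subUset sub1set eU /=; apply: subset_trans QU _.
  by apply/subsetP => f; rewrite !inE => /subset_trans; apply; exact: subsetDl.
have key : ((\sum_(e in edges_in U) #|[set P | matching m P & P \subset edges_in (U :\: val e)]|)
   * (m`! * 2 ^ m) = 'C(#|U|, 2) * (#|U| - 2) ^_ m.*2)%N.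
  rewrite big_distrl /= -card_edges_in -sum_nat_const; apply: eq_bigr => e.
  by rewrite inE IHm => eU; rewrite cardsD (setIidPr eU) card_edge.
have bin2u : ('C(#|U|, 2) * 2 = #|U| * #|U|.-1)%N.
  by rewrite -[in LHS](_ : 2`! = 2)%N // bin_ffact !ffactnS ffactn0 muln1.
rewrite factS expnS (_ : #|M| * _ = #|M| * m.+1 * (m`! * 2 ^ m) * 2)%N; last by ring.
by rewrite count key mulnAC bin2u doubleS !ffactnS mulnA -subn2.
Qed.

End Crosses.

(** * Size bias and first moment bounds *)

Section SizeBias.
Variables (R : realType) (n : nat) (p : R) (d : nat).
Hypothesis p01 : 0 <= p <= 1.
Implicit Types (G : graph n) (P Q : {set edge n}) (V : {set 'I_n}).

Local Notation pr := (gnp_pr p).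
Local Notation mean := (gnp_mean p).
Local Notation cross_size := (2 * (d + 1) * d)%N.

Let p0 : 0 <= p. Proof. by case/andP: p01. Qed.
Let p1 : p <= 1. Proof. by case/andP: p01. Qed.

(** Antipodal pairs are allowed to be edges of G. This makes the count increasing in G, as the size
    bias requires; on sparse graphs the copies are induced by [cross_induced]. *)
Definition cross_count G := #|[set P in crosses n d | cross_edges P \subset G]|.

Definition cross_mean : R := #|crosses n d|%:R * p ^+ cross_size.

Lemma cross_countE G :
  (cross_count G)%:R = \sum_(P in crosses n d) (cross_edges P \subset G)%:R :> R.
Proof.
rewrite /cross_count -sum1_card natr_sum [LHS]big_mkcond [RHS]big_mkcond /=.
by apply: eq_bigr => P _; rewrite inE; case: (P \in _); case: (_ \subset _).
Qed.

Lemma crossesP P : P \in crosses n d -> matching d.+1 P.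
Proof. by rewrite inE. Qed.

Lemma mean_cross_count : mean (fun G => (cross_count G)%:R) = cross_mean.
Proof.
rewrite (eq_gnp_mean (g := fun G => \sum_(P in crosses n d)
   (cross_edges P \subset G)%:R)) => [|G]; last exact: cross_countE.
rewrite gnp_mean_sum /cross_mean -sumr_const mulr_suml; apply: eq_bigr => P /crossesP Pm.
by rewrite -[LHS]/(pr _) gnp_pr_subset (card_cross_edges Pm) mul1r.
Qed.

Lemma cross_mean_ge0 : 0 <= cross_mean.
Proof. by rewrite mulr_ge0 ?ler0n ?exprn_ge0. Qed.

(** Markov's inequality; it keeps mass from escaping to infinity in the limit. *)
Lemma cross_count_tail k : pr (fun G => (k < cross_count G)%N) <= cross_mean / k.+1%:R.
Proof.
rewrite ler_pdivlMr ?ltr0Sn // mulrC -mean_cross_count -gnp_meanZ.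
apply: gnp_mean_le => // G; case: ltnP => kG; first by rewrite mulr1 ler_nat.
by rewrite mulr0 ler0n.
Qed.

(** Both sides are the mean of the count on the event that it equals k + 1, expanded on the right
    over the cross-polytopes present. *)
Lemma size_bias k : k.+1%:R * pr (fun G => cross_count G == k.+1) =
  \sum_(P in crosses n d) p ^+ cross_size *
     pr (fun G => cross_count (G :|: cross_edges P) == k.+1).
Proof.
rewrite -gnp_meanZ (eq_gnp_mean (g := fun G => \sum_(P in crosses n d)
   (cross_edges P \subset G)%:R * (cross_count G == k.+1)%:R)) => [|G].
  rewrite gnp_mean_sum; apply: eq_bigr => P /crossesP Pm.
  by rewrite gnp_mean_subset (card_cross_edges Pm).
rewrite -mulr_suml -cross_countE.
by case: eqP => [->//|_]; rewrite !mulr0.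
Qed.

Lemma cross_count_add P G : P \in crosses n d -> ~~ (cross_edges P \subset G) ->
    (forall Q, Q \in crosses n d -> Q != P -> cross_edges P :&: cross_edges Q != set0 ->
       ~~ (cross_edges Q \subset G :|: cross_edges P)) ->
  cross_count (G :|: cross_edges P) = (cross_count G).+1.
Proof.
move=> Pc PG H.
pose A := [set Q in crosses n d | cross_edges Q \subset G].
have PA : P \notin A by rewrite inE (negPf PG) andbF.
transitivity #|P |: A|; last by rewrite cardsU1 PA.
apply: eq_card => Q; rewrite in_setU1 !in_set.
case: (eqVneq Q P) => [->|QP] /=; first by rewrite (crossesP Pc) subsetUr.
case: (boolP (matching d.+1 Q)) => //= Qm.
have Qc : Q \in crosses n d by rewrite inE.
case: (eqVneq (cross_edges P :&: cross_edges Q) set0) => [PQ|PQ].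
  by rewrite setUC -subDset (setDidPl _) // -setI_eq0 setIC PQ.
have nQ := H _ Qc QP PQ; rewrite (negPf nQ); apply/esym/negbTE.
by apply: contraNN nQ => /subset_trans; apply; exact: subsetUl.
Qed.

(** The count grows by exactly one unless P is already present or adding P completes another
    cross-polytope that shares an edge with it; the bound sums over these events. *)
Lemma pr_cross_add P k : P \in crosses n d ->
  `|pr (fun G => cross_count (G :|: cross_edges P) == k.+1) -
    pr (fun G => cross_count G == k)| <=
  p ^+ cross_size + \sum_(Q in crosses n d |
     (Q != P) && (cross_edges P :&: cross_edges Q != set0))
       p ^+ #|cross_edges Q :\: cross_edges P|.
Proof.
move=> Pc; have Pm := crossesP Pc; rewrite -gnp_meanB.
apply: le_trans (gnp_mean_norm p01 _) _.
rewrite -(card_cross_edges Pm) -gnp_pr_subset.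
under eq_bigr do rewrite -gnp_pr_subsetU.
rewrite -gnp_mean_sum -gnp_meanD; apply: gnp_mean_le => // G.
set S := \sum_(Q in _ | _) _.
have S0 : 0 <= S by apply: sumr_ge0 => Q _; rewrite ler0n.
have D1 (a b : bool) : `|a%:R - b%:R| <= 1 :> R.
  by case: a; case: b; rewrite ?subrr ?subr0 ?sub0r ?normrN ?normr1 ?normr0 ?ler01.
case: (boolP (cross_edges P \subset G)) => PG.
  by apply: le_trans (D1 _ _) _; rewrite lerDl.
case: (boolP [exists Q in crosses n d, [&& Q != P,
   cross_edges P :&: cross_edges Q != set0 & cross_edges Q \subset G :|: cross_edges P]]).
  move=> /exists_inP[Q Qc /and3P[QP PQ QG]].
  apply: le_trans (D1 _ _) _; rewrite add0r /S (bigD1 Q) /=; last by rewrite Qc QP.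
  by rewrite QG lerDl; apply: sumr_ge0 => ? _; rewrite ler0n.
move=> /exists_inPn H; rewrite cross_count_add // => [|Q Qc QP PQ].
  by rewrite eqSS subrr normr0 addr_ge0 ?ler0n.
by have := H _ Qc; rewrite QP PQ.
Qed.

Lemma poisson_recursion k :
  `|k.+1%:R * pr (fun G => cross_count G == k.+1) -
    cross_mean * pr (fun G => cross_count G == k)| <=
  cross_mean * p ^+ cross_size + \sum_(P in crosses n d) \sum_(Q in crosses n d |
     (Q != P) && (cross_edges P :&: cross_edges Q != set0))
       p ^+ #|cross_edges P :|: cross_edges Q|.
Proof.
rewrite size_bias /cross_mean -sumr_const !mulr_suml -sumrB -big_split /=.
apply: le_trans (ler_norm_sum _ _ _) _; apply: ler_sum => P Pc.
rewrite !mul1r -mulrBr normrM ger0_norm ?exprn_ge0 //.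
apply: le_trans (ler_wpM2l _ (pr_cross_add k Pc)) _; first exact: exprn_ge0.
rewrite mulrDr mulr_sumr lerD2l; apply: ler_sum => Q _.
rewrite -exprD -(card_cross_edges (crossesP Pc)) cardsU cardsD setIC.
by rewrite addnBA // subset_leq_card // subsetIr.
Qed.

Lemma overlap_le P Q : P \in crosses n d -> Q \in crosses n d -> Q != P ->
    cross_edges P :&: cross_edges Q != set0 ->
  p ^+ #|cross_edges P :|: cross_edges Q| <=
  p ^+ (d * #|vertices P :|: vertices Q|).+1.
Proof.
move=> /crossesP Pm /crossesP Qm QP PQ; apply: ler_wiXn2l => //.
by apply: cross_overlap => //; rewrite eq_sym.
Qed.

(* The union of two cross-polytopes has at most 4(d+1) vertices. *)
Definition sparse_size := (4 * d.+1)%N.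

Definition sparse_sum : R :=
  \sum_(V : {set 'I_n} | (#|V| <= sparse_size)%N) p ^+ (d * #|V|).+1.

(** A crude bound on the number of graphs on a given set of at most [sparse_size] vertices. *)
Definition small_const : R := (2 ^ (sparse_size * sparse_size))%:R.

Lemma card_powerset_edges V : (#|V| <= sparse_size)%N ->
  #|powerset (edges_in V)|%:R <= small_const.
Proof.
move=> VM; rewrite ler_nat card_powerset card_edges_in leq_exp2l //.
apply: leq_trans (_ : #|V| * #|V| <= _)%N; last exact: leq_mul.
by rewrite bin2; apply: leq_trans (leq_mul (leqnn _) (leq_pred _)); rewrite -divn2 leq_div.
Qed.

(** Group the pairs by their joint vertex set, on which P and Q are two of boundedly many edge
    sets. *)
Lemma overlap_sum_le :
  \sum_(P in crosses n d) \sum_(Q in crosses n d |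
     (Q != P) && (cross_edges P :&: cross_edges Q != set0))
       p ^+ #|cross_edges P :|: cross_edges Q| <=
  small_const * small_const * sparse_sum.
Proof.
rewrite pair_big_dep /=.
pose W (x : {set edge n} * {set edge n}) := vertices x.1 :|: vertices x.2.
apply: (@le_trans _ _ (\sum_(V : {set 'I_n} | (#|V| <= sparse_size)%N)
   \sum_(x in setX (powerset (edges_in V)) (powerset (edges_in V))) p ^+ (d * #|V|).+1)).
  rewrite (partition_big W (fun V => #|V| <= sparse_size)%N) /=; last first.
    move=> [P Q] /= /andP[/crossesP Pm /andP[/crossesP Qm _]].
    apply: leq_trans (leq_card_setU _ _) _.
    by rewrite (card_vertices Pm) (card_vertices Qm) /sparse_size; lia.
  apply: ler_sum => V _; rewrite big_mkcond [leRHS]big_mkcond; apply: ler_sum => -[P Q] _ /=.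
  case: ifP => [/andP[/andP[Pc /and3P[Qc QP PQ]] /eqP <-]|_]; last first.
    by case: ifP => // _; rewrite exprn_ge0.
  rewrite /W /= inE !inE /= !sub_edges_in subsetUl subsetUr /=.
  exact: overlap_le.
rewrite /sparse_sum mulr_sumr; apply: ler_sum => V VM.
rewrite sumr_const cardsX -mulr_natl natrM ler_wpM2r ?exprn_ge0 //.
by apply: ler_pM; rewrite ?ler0n // card_powerset_edges.
Qed.

Definition small_dense G := [exists V : {set 'I_n},
  (#|V| <= sparse_size)%N && (d * #|V| < #|G :&: edges_in V|)%N].

Lemma pr_small_dense : pr small_dense <= small_const * sparse_sum.
Proof.
apply: (@le_trans _ _ (\sum_(V : {set 'I_n} | (#|V| <= sparse_size)%N)
   \sum_(E in powerset (edges_in V)) p ^+ (d * #|V|).+1)); last first.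
  rewrite /sparse_sum mulr_sumr; apply: ler_sum => V VM.
  by rewrite sumr_const -mulr_natl ler_wpM2r ?exprn_ge0 // card_powerset_edges.
rewrite pair_big_dep /=.
apply: (@le_trans _ _ (\sum_(x : {set 'I_n} * {set edge n} | (#|x.1| <= sparse_size)%N &&
    ((x.2 \in powerset (edges_in x.1)) && (#|x.2| == (d * #|x.1|).+1))) p ^+ #|x.2|)).
  apply: gnp_pr_union => // G /existsP[V /andP[VM Vd]].
  have le0 : (#|set0 : {set edge n}| <= (d * #|V|).+1 <= #|G :&: edges_in V|)%N.
    by rewrite cards0.
  have [E [_ EG Ec]] := set_between (sub0set _) le0.
  move: EG; rewrite subsetI => /andP[EG EV].
  by exists (V, E) => //=; rewrite VM inE EV Ec eqxx.
rewrite big_mkcond [leRHS]big_mkcond; apply: ler_sum => -[V E] _ /=.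
case: ifP => [/andP[-> /andP[-> /eqP ->]]//|_].
by case: ifP => // _; rewrite exprn_ge0.
Qed.

(** There are at most n^v sets of v vertices, so the size v contributes at most p (n p^d)^v. *)
Lemma sparse_sum_le : n%:R * p ^+ d <= 1 -> sparse_sum <= sparse_size.+1%:R * p.
Proof.
move=> npd; rewrite /sparse_sum.
rewrite (partition_big (fun V : {set 'I_n} => inord #|V| : 'I_sparse_size.+1) predT) //=.
rewrite mulrC mulr_natr -[X in _ *+ X](card_ord sparse_size.+1) -sumr_const.
apply: ler_sum => v _.
apply: (@le_trans _ _ (\sum_(V in [set V : {set 'I_n} | #|V| == v]) p ^+ (d * v).+1)).
  rewrite big_mkcond [leRHS]big_mkcond; apply: ler_sum => V _; rewrite inE.
  case: ifP => [/andP[VM /eqP <-]|_]; first by rewrite inordK ?ltnS // eqxx.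
  by case: ifP => // _; rewrite exprn_ge0.
rewrite sumr_const card_draws card_ord -mulr_natl exprS mulrCA ler_piMr //.
rewrite exprM; apply: le_trans (_ : (n%:R * p ^+ d) ^+ v <= 1); last first.
  by rewrite exprn_ile1 // mulr_ge0 ?ler0n ?exprn_ge0.
rewrite exprMn -natrX ler_wpM2r ?exprn_ge0 ?ler_nat //.
apply: leq_trans (_ : n ^_ v <= _)%N; first by rewrite -bin_ffact leq_pmulr // fact_gt0.
by rewrite ffact_prod -[in leqRHS](card_ord v) -prod_nat_const leq_prod // => i _; lia.
Qed.

End SizeBias.

(** * Dense strongly connected sets *)

Section TreeBound.
Variables (n d : nat).
Implicit Types (G : graph n).

Definition gadj G : rel 'I_n := fun u v => [exists e in G, val e == [set u; v]].

Lemma gadjC G : symmetric (gadj G).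
Proof. by move=> u v; rewrite /gadj; apply: eq_existsb => e; rewrite setUC. Qed.

Lemma is_clique_gadj G s : is_clique G s = clique (gadj G) s.
Proof.
apply/is_cliqueP/cliqueP => cl u v us vs uv.
  by have [e eG eE] := cl u v us vs uv; apply/exists_inP; exists e; rewrite ?eE.
by have /exists_inP[e eG /eqP eE] := cl u v us vs uv; exists e.
Qed.

Definition contains_shape G := [exists k : 'I_n.+1,
  exists phi : {ffun 'I_k -> 'I_n}, exists B : {ffun 'I_k -> {set 'I_k}},
  [&& injectiveb phi, B \in shapes d k &
      [forall i, forall j in B i, gadj G (phi i) (phi j)]]].

Lemma tree_spanned_sparse G : (0 < d)%N -> ~~ contains_shape G ->
  forall V R : {set 'I_n}, tree_spanned (gadj G) d V R ->
    (\sum_(v in V) #|nbrs (gadj G) V v| <= d.*2 * #|V|)%N.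
Proof.
move=> d0 nG V R VR; rewrite leqNgt; apply: contraNN nG => dense.
have [k [phi [B [phi_inj Bk BG]]]] := dense_shape (@gadjC G) d0 VR dense.
have kn : (k < n.+1)%N.
  by rewrite ltnS -[k]card_ord -[n]card_ord; exact: leq_card phi_inj.
apply/existsP; exists (Ordinal kn); apply/existsP; exists phi; apply/existsP; exists B.
rewrite Bk /=; apply/andP; split; first exact/injectiveP.
by apply/forallP => i; apply/forall_inP => j; exact: BG.
Qed.

Definition shape_edges k (phi : {ffun 'I_k -> 'I_n}) (B : {ffun 'I_k -> {set 'I_k}}) :
  {set edge n} :=
  [set e | [exists i, exists j in B i, val e == [set phi i; phi j]]].

(** Each edge is listed only at its later endpoint, so distinct pairs give distinct edges. *)
Lemma card_shape_edges k (phi : {ffun 'I_k -> 'I_n}) B :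
  injective phi -> B \in shapes d k -> #|shape_edges phi B| = (d * k).+1.
Proof.
move=> phi_inj; rewrite inE => /and3P[/forallP Blt /eqP <- _].
have lt i j : j \in B i -> (j < i)%N by have /forall_inP := Blt i; apply.
rewrite -(card_imset _ val_inj).
under [RHS]eq_bigr do rewrite -sum1_card.
rewrite pair_big_dep sum1dep_card /=.
rewrite -(card_in_imset (f := fun x : 'I_k * 'I_k => [set phi x.1; phi x.2])).
  apply: eq_card => s; apply/imsetP/imsetP => [[e]|[[i j]]].
    rewrite inE => /existsP[i /exists_inP[j jB /eqP eE]] ->.
    by exists (i, j) => //; rewrite inE.
  rewrite inE /= => jB ->.
  have ne : phi i != phi j by rewrite (inj_eq phi_inj) -val_eqE gtn_eqF // lt.
  have [e eE] := edge_exists ne; exists e => //.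
  by rewrite inE; apply/existsP; exists i; apply/exists_inP; exists j => //; rewrite eE.
move=> [i j] [i' j']; rewrite !inE /= => /lt ji /lt ji' e.
have : phi i' \in [set phi i; phi j] by rewrite e set21.
have : phi j' \in [set phi i; phi j] by rewrite e set22.
have : phi i \in [set phi i'; phi j'] by rewrite -e set21.
have : phi j \in [set phi i'; phi j'] by rewrite -e set22.
rewrite !inE !(inj_eq phi_inj) -!val_eqE /= => 
  /orP[]/eqP h1 /orP[]/eqP h2 /orP[]/eqP h3 /orP[]/eqP h4;
  congr pair; apply: val_inj => /=; lia.
Qed.

Variables (R : realType) (p : R).
Hypothesis p01 : 0 <= p <= 1.
Let p0 : 0 <= p. Proof. by case/andP: p01. Qed.

Lemma gnp_pr_cover (I : finType) (A : I -> pred (graph n)) :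
  gnp_pr p (fun G => [exists i, A i G]) <= \sum_i gnp_pr p (A i).
Proof.
rewrite -gnp_mean_sum; apply: gnp_mean_le => // G.
case: existsP => [[i Ai]|_]; last by apply: sumr_ge0 => i _; rewrite ler0n.
by rewrite (bigD1 i) //= Ai lerDl; apply: sumr_ge0 => j _; rewrite ler0n.
Qed.

Lemma pr_contains_shape_sum :
  gnp_pr p contains_shape <=
  \sum_(k < n.+1) (n ^ k * #|shapes d k|)%:R * p ^+ (d * k).+1.
Proof.
apply: le_trans (gnp_pr_cover _) _; apply: ler_sum => k _.
apply: (@le_trans _ _ (\sum_(x : {ffun 'I_k -> 'I_n} * {ffun 'I_k -> {set 'I_k}} |
    injectiveb x.1 && (x.2 \in shapes d k)) p ^+ #|shape_edges x.1 x.2|)).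
  apply: gnp_pr_union => // G /existsP[phi /existsP[B /and3P[ij Bk /forallP BG]]].
  exists (phi, B); rewrite ?ij //=; apply/subsetP => e.
  rewrite inE => /existsP[i /exists_inP[j jB /eqP eE]].
  have /forall_inP/(_ j jB)/exists_inP[e' e'G /eqP e'E] := BG i.
  by rewrite (_ : e = e') //; apply: val_inj; rewrite eE.
rewrite (eq_bigr (fun=> p ^+ (d * k).+1)) => [|[phi B] /andP[/injectiveP ij Bk]]; last first.
  by rewrite card_shape_edges.
rewrite sumr_const -[leLHS]mulr_natl ler_wpM2r ?exprn_ge0 // ler_nat.
have <- : #|setX [set: {ffun 'I_k -> 'I_n}] (shapes d k)| = (n ^ k * #|shapes d k|)%N.
  by rewrite cardsX cardsT card_ffun !card_ord.
by apply: subset_leq_card; apply/subsetP => -[phi B] /andP[_ Bk]; rewrite in_setX in_setT.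
Qed.

(** Bounds k^m by m! times the binomial coefficient of k + m over m. It absorbs the polynomial
    factor of the extra edges into an exponential one. *)
Lemma expn_le_fact k m : (k ^ m <= m`! * 2 ^ m * 2 ^ k)%N.
Proof.
apply: (@leq_trans ((k + m) ^_ m)).
  rewrite ffact_prod -[in leqLHS](card_ord m) -prod_nat_const; apply: leq_prod => i _.
  by have := ltn_ord i; lia.
rewrite -bin_ffact mulnC -mulnA leq_mul2l -expnD [(m + k)%N]addnC; apply/orP; right.
have -> : (2 ^ (k + m) = \sum_(i < (k + m).+1) 'C(k + m, i))%N.
  by rewrite -[2%N]/(1 + 1)%N Pascal; apply: eq_bigr => i _; rewrite !exp1n !muln1.
rewrite (bigD1 (inord m : 'I_(k + m).+1)) //= inordK ?leq_addr //.
by rewrite ltnS leq_addl.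
Qed.

Definition shape_const : nat := (2 * ((2 * excess d)`! * 2 ^ (2 * excess d)))%N.
(** The exponent collects [mask_size] for the masks, 2 for the parents, 1 for the absorbed
    polynomial factor, and 1 more so that the series over k has ratio 1/2. *)
Definition shape_base : nat := (2 ^ (mask_size d + 4))%N.

Lemma pr_contains_shape : shape_base%:R * (n%:R * p ^+ d) <= 1 ->
  gnp_pr p contains_shape <= shape_const%:R * p.
Proof.
move=> small; apply: le_trans pr_contains_shape_sum _.
set c := ((2 * excess d)`! * 2 ^ (2 * excess d))%N.
have y0 : 0 <= n%:R * p ^+ d by rewrite mulr_ge0 ?ler0n ?exprn_ge0.
apply: (@le_trans _ _ (\sum_(k < n.+1) c%:R * p * (2^-1) ^+ k)).
  apply: ler_sum => k _.
  have le1 : (#|shapes d k| <= c * (2 ^ (mask_size d + 3)) ^ k)%N.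
    apply: leq_trans (card_shapes _ _) _.
    rewrite mulnn -expnM expnM -expnMn.
    apply: leq_trans (leq_mul (leqnn _) (expn_le_fact k (2 * excess d))) _.
    by rewrite -/c mulnCA -expnMn expnD (mulnC 4%N) -mulnA.
  apply: (@le_trans _ _ (c%:R * p * ((2 ^ (mask_size d + 3))%:R * (n%:R * p ^+ d)) ^+ k)).
    have lec : #|shapes d k|%:R <= c%:R * (2 ^ (mask_size d + 3))%:R ^+ k :> R.
      by rewrite -natrX -natrM ler_nat.
    rewrite natrM natrX exprS exprM !exprMn.
    rewrite [leLHS](_ : _ = #|shapes d k|%:R * (n%:R ^+ k * (p * p ^+ d ^+ k))); last by ring.
    rewrite [leRHS](_ : _ = c%:R * (2 ^ (mask_size d + 3))%:R ^+ k *
      (n%:R ^+ k * (p * p ^+ d ^+ k))); last by ring.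
    by rewrite ler_wpM2r // !mulr_ge0 ?exprn_ge0 ?ler0n.
  rewrite ler_wpM2l ?mulr_ge0 ?ler0n // lerXn2r ?nnegrE ?invr_ge0 ?mulr_ge0 ?ler0n ?exprn_ge0 //.
  move: small; rewrite /shape_base !expnD (_ : (2 ^ 4)%N = (2 * 2 ^ 3)%N) // !natrM.
  by lra.
rewrite -mulr_sumr /shape_const -/c natrM.
have -> : \sum_(k < n.+1) 2^-1 ^+ k = 2 - 2 * 2^-1 ^+ n.+1 :> R.
  elim: n.+1 => [|m IHm]; first by rewrite big_ord0 expr0; lra.
  by rewrite big_ord_recr /= IHm exprS; lra.
have : 0 <= c%:R * p * 2^-1 ^+ n.+1 by rewrite !mulr_ge0 ?ler0n ?exprn_ge0 ?invr_ge0.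
by nra.
Qed.

End TreeBound.

(** * The Betti number of a typical graph *)

Section GoodGraph.
Variables (n d : nat) (G : graph n).
Hypothesis not_dense : ~~ small_dense d G.
Implicit Types (P Q : {set edge n}) (V f : {set 'I_n}).

Local Notation adj := (gadj G).

Definition cocktails : {set {set 'I_n}} :=
  [set V | cocktail adj V & #|V| == d.+1.*2].

Lemma sparse_edges V : (#|V| <= sparse_size d)%N -> (#|G :&: edges_in V| <= d * #|V|)%N.
Proof.
move=> VM; move/existsPn: not_dense => /(_ V).
by rewrite VM /= -leqNgt.
Qed.

Lemma deg_nonnbrs V v : v \in V -> deg (edges_in V :\: G) v = #|nonnbrs adj V v|.
Proof.
move=> vV; rewrite -(card_imset _ set1_inj).
rewrite /deg -(card_in_imset (f := fun e : edge n => val e :\ v)); last first.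
  move=> e e'; rewrite !inE => /andP[_ ve] /andP[_ ve'] eq.
  by apply: val_inj; rewrite -(setD1K ve) -(setD1K ve') eq.
apply: eq_card => s; apply/imsetP/imsetP => [[e]|[u]].
  rewrite !inE => /andP[/andP[eG eV] ve] ->.
  have /eqP/cards1P[u uE] : #|val e :\ v| = 1%N.
    by have := card_edge e; rewrite (cardsD1 v) ve => -[].
  exists u => //; have : u \in val e :\ v by rewrite uE set11.
  rewrite !inE => /andP[-> /(subsetP eV) ->] /=.
  apply: contra eG => /exists_inP[e' e'G /eqP e'E].
  by rewrite (_ : e = e') //; apply: val_inj; rewrite e'E -(setD1K ve) uE.
rewrite !inE => /and3P[uV uv nadj] ->; have [e eE] := edge_exists uv.
exists e; rewrite ?inE eE.
  rewrite set22 subUset !sub1set uV vV !andbT.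
  by apply: contra nadj => eG; apply/exists_inP; exists e; rewrite // eE setUC.
apply/setP => x; rewrite !inE; case: (eqVneq x v) => [->|] /=; rewrite ?orbF //.
by rewrite eq_sym (negPf uv).
Qed.

(** A cross-polytope already has exactly d edges per vertex, the most that a small set may have. *)
Lemma cross_induced P : matching d.+1 P -> cross_edges P \subset G ->
  G :&: edges_in (vertices P) = cross_edges P.
Proof.
move=> Pm PG; apply/esym/eqP; rewrite eqEcard subsetI PG subsetDl /=.
rewrite (card_cross_edges Pm); apply: leq_trans (sparse_edges _) _.
  by rewrite (card_vertices Pm) /sparse_size; clear; lia.
by rewrite (card_vertices Pm); lia.
Qed.

Lemma matching_nonedges P : matching d.+1 P -> cross_edges P \subset G ->
  edges_in (vertices P) :\: G = P.
Proof.
move=> Pm PG; rewrite -[LHS]setU0 -(setDv (edges_in (vertices P))) -setDIr.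
rewrite cross_induced // /cross_edges setDDr setDv set0U; apply/setIidPr.
by rewrite sub_edges_in.
Qed.

Lemma vertices_cocktail P : matching d.+1 P -> cross_edges P \subset G ->
  vertices P \in cocktails.
Proof.
move=> Pm PG; rewrite inE (card_vertices Pm) eqxx andbT.
apply/forall_inP => v vP; rewrite -deg_nonnbrs // matching_nonedges //.
by rewrite (deg_matching Pm).
Qed.

Lemma cocktail_matching V : V \in cocktails ->
  exists P, [/\ matching d.+1 P, cross_edges P \subset G & vertices P = V].
Proof.
rewrite inE => /andP[/forall_inP cV /eqP Vd].
set P := edges_in V :\: G; have PV : P \subset edges_in V by exact: subsetDl.
have degP v : v \in V -> deg P v = 1%N.
  by move=> vV; rewrite deg_nonnbrs //; apply/eqP/cV.
have Pc : #|P| = d.+1.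
  apply: double_inj; rewrite -(handshake PV) -Vd -sum1_card.
  exact: eq_bigr.
have Pm : matching d.+1 P.
  apply/matchingP; split=> // e e' eP e'P; apply: contraNT.
  rewrite -setI_eq0 => /set0Pn[v /setIP[ve ve']].
  have vV : v \in V.
    by have := subsetP PV _ eP; rewrite inE => /subsetP; apply.
  have /eqP/cards1P[x xE] := degP _ vV.
  have : e \in [set e in P | v \in val e] by rewrite inE eP.
  have : e' \in [set e in P | v \in val e] by rewrite inE e'P.
  by rewrite xE !inE => /eqP -> /eqP ->.
have VP : vertices P = V.
  apply/eqP; rewrite eqEcard (card_vertices Pm) Vd leqnn andbT.
  by rewrite -sub_edges_in.
exists P; split=> //; rewrite /cross_edges VP /P setDDr setDv set0U.
exact: subsetIr.
Qed.

Lemma card_cocktails : #|cocktails| = cross_count d G.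
Proof.
rewrite /cross_count -(card_in_imset (f := @vertices n)); last first.
  move=> P Q; rewrite !inE => /andP[Pm PG] /andP[Qm QG] e.
  by rewrite -(matching_nonedges Pm PG) e matching_nonedges.
apply: eq_card => V; apply/idP/imsetP => [/cocktail_matching[P [Pm PG <-]]|[P]].
  by exists P => //; rewrite !inE Pm.
by rewrite !inE => /andP[Pm PG] ->; have := vertices_cocktail Pm PG; rewrite inE.
Qed.

(** A common facet contains a common edge, and by [cross_overlap] two distinct cross-polytopes
    sharing an edge span a small dense set. *)
Lemma cocktails_disjoint V V' f : (2 <= d)%N -> V \in cocktails -> V' \in cocktails ->
  f \subset V -> f \subset V' -> #|f| = d.+1 -> clique adj f -> V = V'.
Proof.
move=> d2 /cocktail_matching[P [Pm PG <-]] /cocktail_matching[Q [Qm QG <-]].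
move=> fP fQ fd /cliqueP fcl; case: (eqVneq P Q) => [->//|PQ].
have [u [v [uf vf uv]]] : exists u v, [/\ u \in f, v \in f & u != v].
  by apply/card_gt1P; rewrite fd ltnS; lia.
have /exists_inP[e eG /eqP eE] := fcl _ _ uf vf uv.
have mem X : matching d.+1 X -> cross_edges X \subset G -> f \subset vertices X ->
    e \in cross_edges X.
  move=> Xm XG fX; rewrite -cross_induced // !inE eG eE subUset !sub1set.
  by rewrite !(subsetP fX).
have meet : cross_edges P :&: cross_edges Q != set0.
  by apply/set0Pn; exists e; rewrite in_setI !mem.
have := cross_overlap Pm Qm PQ meet; rewrite ltnNge => /negP[].
apply: leq_trans (sparse_edges _); last first.
  apply: leq_trans (leq_card_setU _ _) _.
  by rewrite (card_vertices Pm) (card_vertices Qm) /sparse_size; clear; lia.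
apply: subset_leq_card; rewrite subsetI !subUset PG QG /=.
apply/andP; split; apply: subset_trans (subsetDl _ _) _;
  by apply/subsetP => x; rewrite !inE => xV; apply: subset_trans xV _; rewrite ?subsetUl ?subsetUr.
Qed.

(** For w in V, the facet f contains the antipode of w. For w outside V, the d + 1 edges from w to f
    bring the total to 2d(d + 1) + d + 1, one more than d times 2d + 3 vertices. *)
Lemma cocktails_maximal V f w : V \in cocktails -> f \subset V ->
  #|f| = d.+1 -> w \notin f -> clique adj (w |: f) -> False.
Proof.
move=> VC fV fd wf wcl; have := VC; rewrite inE => /andP[cV /eqP Vd].
have fcl : clique adj f by apply: cliqueS wcl; exact: subsetUr.
case: (boolP (w \in V)) => wV.
  have [aV aw _ adjE] := antipodeP (gadjC G) cV wV.
  have := clique_transversal (gadjC G) cV Vd fV fd fcl wV; rewrite wf => af.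
  move/cliqueP: wcl => /(_ w (antipode adj V w)); rewrite setU11 inE af orbT.
  by rewrite eq_sym aw adjE // eqxx => /(_ isT isT isT).
have [P [Pm PG VE]] := cocktail_matching VC.
have lt := @sparse_edges (w |: V); rewrite cardsU1 wV Vd /= in lt.
have sz : (1 + d.+1.*2 <= sparse_size d)%N by rewrite /sparse_size; clear; lia.
have {}lt := lt sz; rewrite -(cardsID [set e : edge n | w \in val e]) in lt.
have le1 : (d.+1 <= #|(G :&: edges_in (w |: V)) :&: [set e : edge n | w \in val e]|)%N.
  rewrite -fd -(card_imset f set1_inj).
  apply: leq_trans (leq_imset_card (fun e : edge n => val e :\ w) _).
  apply: subset_leq_card; apply/subsetP => _ /imsetP[x xf ->].
  have xw : x != w by apply: contraNneq wf => <-.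
  move/cliqueP: wcl => /(_ w x); rewrite setU11 inE xf orbT eq_sym xw.
  move=> /(_ isT isT isT)/exists_inP[e eG /eqP eE].
  apply/imsetP; exists e.
    by rewrite !inE eG eE set21 subUset !sub1set setU11 inE (subsetP fV) ?orbT.
  by rewrite eE setU1K // inE eq_sym.
have le2 : (2 * (d + 1) * d <= #|(G :&: edges_in (w |: V)) :\: [set e : edge n | w \in val e]|)%N.
  rewrite -(card_cross_edges Pm); apply: subset_leq_card; apply/subsetP => e eP.
  have eG := subsetP PG _ eP.
  have eV : val e \subset V by move: eP; rewrite !inE VE => /andP[].
  rewrite !inE eG (subset_trans eV (subsetUr _ _)) !andbT.
  by apply: contra wV; exact: (subsetP eV).
by move: lt le1 le2; set a := #|_|; set b := #|_|; clearbody a b; clear; nia.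
Qed.

End GoodGraph.

(** * From chains on vertex sets to the Betti number *)

Section Transfer.
Variables (K : fieldType) (n : nat) (G : graph n).
Implicit Types (s t : {set 'I_n}) (h : {set 'I_n} -> K).

Local Notation X := (clique_complex G).
Local Notation adj := (gadj G).

Definition chain_ext m (c : chain K X m) s : K :=
  if insub s : option (face X m) is Some f then c f else 0.

Definition chain_res m h : chain K X m := [ffun f : face X m => h (val f)].

Lemma chain_extK m : cancel (@chain_ext m) (chain_res m).
Proof. by move=> c; apply/ffunP => f; rewrite ffunE /chain_ext valK. Qed.

Lemma clique_face m s : (0 < m)%N -> #|s| = m -> clique adj s ->
  (s \in X) && (#|s| == m).
Proof.
move=> m0 sm scl; rewrite inE is_clique_gadj scl sm eqxx -card_gt0 sm m0.
by [].
Qed.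

Lemma chain_extE m c (f : face X m) : chain_ext c (val f) = c f.
Proof. by rewrite /chain_ext valK. Qed.

Lemma chain_ext_supported m (c : chain K X m) :
  supported adj [set: 'I_n] m (chain_ext c).
Proof.
move=> s; rewrite /chain_ext; case: insubP => [f|]; last by rewrite eqxx.
rewrite inE is_clique_gadj => /andP[/andP[_ scl] /eqP sm] _ _.
by split; rewrite ?subsetT.
Qed.

Lemma chain_resK m h : (0 < m)%N -> supported adj [set: 'I_n] m h ->
  chain_ext (chain_res m h) =1 h.
Proof.
move=> m0 sh s; rewrite /chain_ext; case: insubP => [f _ <-|nf]; first by rewrite ffunE.
apply/esym/eqP; apply: contraNT nf => /sh[_ sm scl].
exact: clique_face.
Qed.

Lemma boundaryE m (c : chain K X m.+1) :
  boundary K X m c = chain_res m (bd (chain_ext c)).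
Proof.
rewrite lfunE /=; apply/ffunP => t; rewrite !ffunE /bd /incidence.
under eq_bigr do rewrite mulr_suml.
rewrite (exchange_big_dep (fun v => v \notin val t)) /=; last first.
  by move=> s v _ /andP[_ /eqP <-]; rewrite setD11.
apply: eq_bigr => v vt.
have rankE : vertex_rank (v |: val t) v = #|[set u in val t | (u < v)%N]|.
  apply: eq_card => u; rewrite !inE; case: (eqVneq u v) => //= ->.
  by rewrite ltnn andbF.
have selE (s : face X m.+1) : (v \in val s) && (val s :\ v == val t) = (val s == v |: val t).
  apply/andP/eqP => [[vs /eqP <-]|->]; first by rewrite setD1K.
  by rewrite setU11 setU1K.
rewrite (eq_bigl _ _ selE) /chain_ext; case: insubP => [f _ fE|nf].
  rewrite (big_pred1 f) => [|s]; last by rewrite -fE -val_eqE.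
  by rewrite fE rankE.
rewrite mulr0 big1 // => s /eqP sE; exfalso; move/negP: nf; apply.
by rewrite -sE; exact: valP s.
Qed.

(** Where the boundary of c is nonzero, t is a clique of d vertices, and d > 0 makes it a nonempty
    face; so the augmented complex has the same d-cycles. *)
Lemma cyclesP d (c : chain K X d.+1) : (0 < d)%N ->
  reflect (cycle (chain_ext c)) (c \in cycles K X d).
Proof.
move=> d0; rewrite memv_ker boundaryE; apply: (iffP eqP) => [c0 t|c0]; last first.
  by apply/ffunP => t; rewrite !ffunE c0.
apply/eqP; apply: contraT => bt.
have [v vt cv] : exists2 v, v \notin t & chain_ext c (v |: t) != 0.
  apply: contrapT => nz; move/eqP: bt; apply; apply: big1 => v vt.
  suff -> : chain_ext c (v |: t) = 0 by rewrite mulr0.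
  by apply/eqP/negPn/negP => cv; apply: nz; exists v.
have [_ tm tcl] := chain_ext_supported cv.
have tf : (t \in X) && (#|t| == d).
  apply: clique_face => //; first by move: tm; rewrite cardsU1 vt => -[].
  by apply: cliqueS tcl; exact: subsetUr.
have := congr1 (fun h : chain K X d => h (exist _ t tf)) c0.
by rewrite /chain_res !ffunE /= => e; rewrite e eqxx in bt.
Qed.

Lemma chain_ext_linear m a (c1 c2 : chain K X m) s :
  chain_ext (a *: c1 + c2) s = a * chain_ext c1 s + chain_ext c2 s.
Proof.
rewrite /chain_ext; case: insub => [f|]; last by rewrite mulr0 addr0.
by rewrite !ffunE.
Qed.

Section Evaluation.
Variables (m N : nat) (fs : 'I_N -> {set 'I_n}).

Definition evaluation_fun (c : chain K X m) : 'rV[K]_N := \row_i chain_ext c (fs i).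

Lemma evaluation_linear : linear evaluation_fun.
Proof. by move=> a c1 c2; apply/rowP => i; rewrite !mxE chain_ext_linear. Qed.

HB.instance Definition _ :=
  GRing.isLinear.Build K (chain K X m) 'rV[K]_N *:%R evaluation_fun evaluation_linear.

Definition evaluation : 'Hom(chain K X m, 'rV[K]_N) := linfun evaluation_fun.

Lemma evaluationE c i : evaluation c 0 i = chain_ext c (fs i).
Proof. by rewrite lfunE /= mxE. Qed.

End Evaluation.

Lemma bd_sum (I : finType) (P : pred I) (F : I -> {set 'I_n} -> K) t :
  bd (fun s => \sum_(i | P i) F i s) t = \sum_(i | P i) bd (F i) t.
Proof.
rewrite [RHS]exchange_big /=; apply: eq_bigr => v _.
by rewrite mulr_sumr.
Qed.

Lemma supported_sum (I : finType) (P : pred I) (F : I -> {set 'I_n} -> K) V m :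
  (forall i, P i -> supported adj V m (F i)) ->
  supported adj V m (fun s => \sum_(i | P i) F i s).
Proof.
move=> sF s; case: (boolP [exists i, P i && (F i s != 0)]).
  by move=> /existsP[i /andP[Pi Fi]] _; exact: sF Fi.
move=> /existsPn nz; rewrite big1 ?eqxx // => i Pi.
by apply/eqP; have := nz i; rewrite Pi negbK.
Qed.

Variable d : nat.
Hypothesis d2 : (2 <= d)%N.
Hypothesis not_dense : ~~ small_dense d G.
Hypothesis no_shape : ~~ contains_shape d G.

(** Scaling to 1 at a facet makes evaluation at these facets dual to the cycles. The zero chain with
    the empty set is the default for other V, so that a choice function over all V exists. *)
Lemma normalized_cycle V : exists zf : ({set 'I_n} -> K) * {set 'I_n},
  V \in cocktails d G ->
  [/\ supported adj V d.+1 zf.1, cycle zf.1 & zf.1 zf.2 = 1].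
Proof.
case: (boolP (V \in cocktails d G)) => [|_]; last by exists (fun=> 0, set0).
rewrite inE => /andP[cV /eqP Vd].
have [c [f [sc cc cf]]] := cocktail_cycle_exists K (gadjC G) cV Vd.
exists (fun s => (c f)^-1 * c s, f) => _ /=; split.
- exact: supportedZ.
- by move=> t; rewrite bdZ cc mulr0.
- by rewrite mulVf.
Qed.

(** Evaluation of cycles at one facet of each cross-polytope is onto because facets are not shared.
    Its kernel is the boundaries: they vanish at facets, which are maximal faces, and all cycles are
    generated. *)
Lemma betti_cross_count : betti K X d = cross_count d G.
Proof.
have d0 : (0 < d)%N by exact: ltnW.
have [zf zfP] := choice normalized_cycle.
pose z V := (zf V).1; pose f V := (zf V).2.
have zP V : V \in cocktails d G -> [/\ supported adj V d.+1 (z V), cycle (z V) & z V (f V) = 1].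
  exact: zfP.
have fP V : V \in cocktails d G -> [/\ f V \subset V, #|f V| = d.+1 & clique adj (f V)].
  by move=> VC; have [sz _ z1] := zP _ VC; apply: sz; rewrite z1 oner_neq0.
have zd V V' : V \in cocktails d G -> V' \in cocktails d G -> z V (f V') = (V == V')%:R.
  move=> VC VC'; have [sz _ z1] := zP _ VC; case: eqVneq => [<-//|ne].
  apply/eqP; apply: contraNT ne => /sz[fV _ _].
  have [fV' fd fcl] := fP _ VC'; apply/eqP.
  exact: (cocktails_disjoint not_dense d2 VC VC' fV fV').
have bd_f V b : V \in cocktails d G -> supported adj [set: 'I_n] d.+2 b -> bd b (f V) = 0 :> K.
  move=> VC sb; have [fV fd fcl] := fP _ VC; apply: big1 => v vf.
  suff -> : b (v |: f V) = 0 by rewrite mulr0.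
  apply/eqP; apply: contraT => /sb[_ _ vcl].
  by case: (cocktails_maximal not_dense VC fV fd vf vcl).
have decomposition c : generated adj d c -> exists b a, supported adj [set: 'I_n] d.+2 b /\
    forall s, c s = bd b s + \sum_(V in cocktails d G) a V * z V s :> K.
  elim=> {c} [b sb|V c cV Vd sc cc|c1 c2 _ [b1 [a1 [s1 e1]]] _ [b2 [a2 [s2 e2]]]|
              c c' cc' _ [b [a [sb e]]]].
  - exists b, (fun=> 0); split=> // s; rewrite big1 ?addr0 // => V _; exact: mul0r.
  - have VC : V \in cocktails d G by rewrite inE cV Vd eqxx.
    have [sz cz z1] := zP _ VC; have [fV fd fcl] := fP _ VC.
    exists (fun=> 0), (fun V' => if V' == V then c (f V) else 0); split.
      by move=> s; rewrite eqxx.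
    move=> s; rewrite bd0 add0r (bigD1 V) //= eqxx big1; last first.
      by move=> V' /andP[_ /negPf ->]; exact: mul0r.
    (* A cycle on a cross-polytope that vanishes at one facet is zero, so c is a multiple of
       [z V]. *)
    rewrite addr0; apply/eqP; rewrite -subr_eq0 -mulNr; apply/eqP.
    apply: (cocktail_cycle_eq0 (gadjC G) cV Vd
      (c := fun s => c s + - c (f V) * z V s) _ _ fV fd fcl).
    + by apply: supportedD => //; exact: supportedZ.
    + by move=> t; rewrite bdD bdZ cc cz mulr0 addr0.
    + by rewrite z1 mulr1 subrr.
  - exists (fun s => b1 s + b2 s), (fun V => a1 V + a2 V); split; first exact: supportedD.
    move=> s; rewrite bdD e1 e2 addrACA; congr (_ + _); rewrite -big_split /=.
    by apply: eq_bigr => V _; rewrite mulrDl.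
  - by exists b, a; split=> // s; rewrite -cc' e.
pose N := #|cocktails d G|.
pose V_ (i : 'I_N) := enum_val i.
have VC i : V_ i \in cocktails d G by exact: enum_valP.
pose ev := evaluation d.+1 (fun i : 'I_N => f (V_ i)).
have kerE : (cycles K X d :&: lker ev)%VS = boundaries K X d.
  apply/vspaceP => c; rewrite memv_cap; apply/andP/idP => [[cc]|].
    rewrite memv_ker => /eqP ev0; have cyc := elimT (cyclesP c d0) cc.
    have [b [a [sb e]]] := decomposition _ (generated_cycle (gadjC G) d2
      (tree_spanned_sparse d0 no_shape) (@chain_ext_supported _ c) cyc).
    (* At [f V] the boundary and all other cycles vanish, so the coefficient is the value of c
       there. *)
    have a0 V : V \in cocktails d G -> a V = 0.
      move=> VCV; have := e (f V); rewrite bd_f // add0r (bigD1 V) //= zd // eqxx mulr1.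
      rewrite big1 ?addr0 => [<-|V' /andP[V'C ne]]; last by rewrite zd // (negPf ne) mulr0.
      have [i ViE] : exists i, V_ i = V.
        by exists (enum_rank_in VCV V); rewrite /V_ enum_rankK_in.
      by rewrite -ViE -(evaluationE (fun i => f (V_ i))) -/ev ev0 mxE.
    have -> : c = boundary K X d.+1 (chain_res d.+2 b).
      rewrite boundaryE -[LHS]chain_extK; apply/ffunP => t; rewrite !ffunE e.
      rewrite big1 ?addr0 => [|V VCV]; last by rewrite a0 ?mul0r.
      by apply: eq_bd => s; rewrite chain_resK.
    by apply: memv_img; exact: memvf.
  move=> cB; split.
    by apply: (subvP (boundaries_sub_cycles _ _ d)) cB; exact: clique_complex_closed.
  have /memv_imgP[b _ ->] := cB; rewrite memv_ker; apply/eqP/rowP => i.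
  rewrite evaluationE mxE boundaryE.
  have [fV fd fcl] := fP _ (VC i).
  have ff : (f (V_ i) \in X) && (#|f (V_ i)| == d.+1) by exact: clique_face.
  rewrite -[f (V_ i)]/(val (exist _ (f (V_ i)) ff : face X d.+1)) chain_extE ffunE /=.
  by rewrite bd_f //; exact: chain_ext_supported.
have imE : (ev @: cycles K X d)%VS = fullv.
  apply/vspaceP => r; rewrite memvf.
  pose h s := \sum_i r 0 i * z (V_ i) s.
  have sh : supported adj [set: 'I_n] d.+1 h.
    apply: supported_sum => i _; apply: supportedZ; have [sz _ _] := zP _ (VC i).
    exact: supportedW (subsetT _) sz.
  have hE := chain_resK (ltn0Sn d) sh.
  have -> : r = ev (chain_res d.+1 h).
    apply/rowP => i; rewrite evaluationE hE /h (bigD1 i) //= zd // eqxx mulr1.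
    rewrite big1 ?addr0 // => j ji; rewrite zd // (inj_eq enum_val_inj) (negPf ji).
    exact: mulr0.
  apply: memv_img; apply/cyclesP => // t; rewrite (eq_bd hE) bd_sum big1 // => i _.
  by rewrite bdZ; have [_ -> _] := zP _ (VC i); rewrite mulr0.
have := limg_ker_dim ev (cycles K X d); rewrite kerE imE dimvf dim_matrix mul1r => dimE.
rewrite bettiE; last exact: clique_complex_closed.
by rewrite -dimE addKn /N card_cocktails.
Qed.

End Transfer.

(** * Asymptotics *)

Section PoissonLimit.
Local Open Scope classical_set_scope.
Variable R : realType.
Implicit Types (u v : nat -> R).

Lemma eq_cvgn u v (l : R) : u =1 v ->
  v n @[n --> \oo] --> l -> u n @[n --> \oo] --> l.
Proof. by move=> /funext ->. Qed.

Lemma cvgM_eq u v (w : nat -> R) (a b l : R) : (forall n, w n = u n * v n) -> l = a * b ->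
  u n @[n --> \oo] --> a -> v n @[n --> \oo] --> b -> w n @[n --> \oo] --> l.
Proof. by move=> /funext -> ->; exact: cvgM. Qed.

Lemma cvg_norm_le0 u v : (\forall n \near \oo, `|u n| <= v n) ->
  v n @[n --> \oo] --> 0 -> u n @[n --> \oo] --> 0.
Proof.
move=> uv v0; apply: (@squeeze_cvgr _ _ _ _ (fun n => - v n) v) => //.
  by near do rewrite -ler_norml.
by rewrite -oppr0; apply: cvgN.
Unshelve. all: by end_near. Qed.

Lemma cvg_sum_ord (f : nat -> nat -> R) (l : nat -> R) K :
  (forall k, f k n @[n --> \oo] --> l k) ->
  (\sum_(k < K) f k n) @[n --> \oo] --> \sum_(k < K) l k.
Proof.
move=> fl; elim: K => [|K IHK].
  by under eq_fun do rewrite big_ord0; rewrite big_ord0; exact: cvg_cst.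
under eq_fun do rewrite big_ord_recr /=.
by rewrite big_ord_recr /=; exact: cvgD.
Qed.

Variables (a : nat -> nat -> R) (mu err : nat -> R) (lam : R).
Hypothesis mu_lam : mu n @[n --> \oo] --> lam.
Hypothesis err0 : err n @[n --> \oo] --> 0.
Hypothesis a01 : forall k n, 0 <= a k n <= 1.
Hypothesis recursion : \forall n \near \oo,
  forall k, `|k.+1%:R * a k.+1 n - mu n * a k n| <= err n.
Hypothesis total : \forall n \near \oo,
  forall K, 1 - mu n / K.+1%:R <= \sum_(k < K.+1) a k n <= 1.

(** The recursion fixes only the ratios of the limiting probabilities; [a 0] is left to be found
    from the total mass. *)
Lemma limit_ratio k : (a k n - lam ^+ k / k`!%:R * a 0 n) @[n --> \oo] --> 0.
Proof.
elim: k => [|k IHk].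
  have E n : a 0 n - lam ^+ 0 / 0`!%:R * a 0 n = 0.
    by rewrite expr0 fact0 divr1 mul1r subrr.
  by apply: (eq_cvgn E); exact: cvg_cst.
have step : (k.+1%:R * a k.+1 n - lam * a k n) @[n --> \oo] --> 0.
  apply: (@cvg_norm_le0 _ (fun n => err n + `|mu n - lam|)).
    near=> n; have r : forall k, `|k.+1%:R * a k.+1 n - mu n * a k n| <= err n.
      by near: n; exact: recursion.
    have -> : k.+1%:R * a k.+1 n - lam * a k n =
        (k.+1%:R * a k.+1 n - mu n * a k n) + (mu n - lam) * a k n by ring.
    apply: le_trans (ler_normD _ _) _; apply: lerD (r k) _.
    have /andP[ak0 ak1] := a01 k n.
    by rewrite normrM (ger0_norm ak0) ler_piMr.
  have -> : 0 = 0 + `|lam - lam| :> R by rewrite subrr normr0 addr0.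
  by apply: cvgD => //; apply: cvg_norm; apply: cvgB => //; exact: cvg_cst.
have E n : a k.+1 n - lam ^+ k.+1 / k.+1`!%:R * a 0 n =
    k.+1%:R^-1 * ((k.+1%:R * a k.+1 n - lam * a k n) +
                  lam * (a k n - lam ^+ k / k`!%:R * a 0 n)).
  have f0 : k`!%:R != 0 :> R by rewrite pnatr_eq0 -lt0n fact_gt0.
  rewrite exprS factS natrM.
  have k0 : k.+1%:R != 0 :> R by rewrite pnatr_eq0.
  by field; rewrite f0; move: k0; rewrite -natr1 addrC.
apply: (eq_cvgn E).
have -> : 0 = k.+1%:R^-1 * (0 + lam * 0) :> R by rewrite mulr0 addr0 mulr0.
by apply: cvgMl_tmp; apply: cvgD => //; exact: cvgMl_tmp.
Unshelve. all: by end_near. Qed.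

(** By the ratios, the total mass is close to [a 0] times a partial sum of the exponential series;
    the Markov bound in [total] permits cutting both at the same K for all large n. *)
Lemma limit0 : a 0 n @[n --> \oo] --> expR (- lam).
Proof.
suff : (a 0 n * expR lam) @[n --> \oo] --> (1 : R).
  move=> H; have -> : expR (- lam) = 1 * (expR lam)^-1 by rewrite mul1r expRN.
  have E n : a 0 n = a 0 n * expR lam * (expR lam)^-1.
    by rewrite mulfK // gt_eqF // expR_gt0.
  by apply: (eq_cvgn E); apply: cvgMr_tmp.
apply/cvgrPdist_lt => e e0.
have e30 : 0 < e / 3 by rewrite divr_gt0.
have exp_cvg : (\sum_(k < K) lam ^+ k / k`!%:R) @[K --> \oo] --> expR lam.
  have := is_cvg_series_exp_coeff lam; rewrite /expR.
  move=> /cvg_ex[l le]; rewrite (cvg_lim _ le) //.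
  move: le; rewrite /series /=; under eq_fun do rewrite big_mkord.
  by [].
(* K makes both the exponential tail and the Markov tail small; lam + 1 eventually bounds [mu]. *)
have [K [Ks Km]] : exists K, `|expR lam - \sum_(k < K.+1) lam ^+ k / k`!%:R| < e / 3 /\
    (lam + 1) / K.+1%:R < e / 3.
  have /cvgrPdist_lt/(_ _ e30)[M _ HM] := exp_cvg.
  have [M' _ HM'] := nbhs_infty_gtr ((lam + 1) / (e / 3)).
  exists (maxn M M'); split.
    by apply: HM; rewrite /= (leq_trans (leq_maxl M M')).
  rewrite ltr_pdivrMr ?ltr0Sn // mulrC -ltr_pdivrMr //.
  apply: HM'; rewrite /=; apply: leq_trans (leq_maxr M M') _.
  exact: leqnSn.
set s := \sum_(k < K.+1) _ in Ks.
have DK : (\sum_(k < K.+1) a k n - s * a 0 n) @[n --> \oo] --> 0.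
  have -> : (fun n => \sum_(k < K.+1) a k n - s * a 0 n) =
      (fun n => \sum_(k < K.+1) (a k n - lam ^+ k / k`!%:R * a 0 n)).
    by apply/funext => n; rewrite sumrB mulr_suml.
  have := cvg_sum_ord (K := K.+1) limit_ratio.
  by rewrite sumr_const mul0rn.
move/cvgrPdist_lt : DK => /(_ _ e30) DK.
have mu1 : \forall n \near \oo, mu n < lam + 1.
  by apply: cvgr_lt mu_lam _ _; rewrite ltrDl.
near=> n.
have D : `|0 - (\sum_(k < K.+1) a k n - s * a 0 n)| < e / 3 by near: n; exact: DK.
have /(_ K) /andP[t1 t2] : forall K, 1 - mu n / K.+1%:R <= \sum_(k < K.+1) a k n <= 1.
  by near: n; exact: total.
have m1 : mu n / K.+1%:R < e / 3.
  apply: le_lt_trans Km; rewrite ler_pM2r ?invr_gt0 ?ltr0Sn //.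
  by apply: ltW; near: n; exact: mu1.
have /andP[a0 a1] := a01 0 n.
set S := \sum_(k < K.+1) a k n in D t1 t2.
have e1 : `|a 0 n * (expR lam - s)| < e / 3.
  rewrite normrM ger0_norm //; apply: le_lt_trans Ks.
  by rewrite ler_piMl.
have -> : 1 - a 0 n * expR lam = (1 - S) - (0 - (S - s * a 0 n)) - a 0 n * (expR lam - s).
  by ring.
move: D e1; rewrite !ltr_norml => /andP[D1 D2] /andP[E1 E2].
clearbody s S; clear -D1 D2 E1 E2 t1 t2 m1; set y := mu n / _ in t1 m1.
set w := a 0 n * _ in E1 E2 *; set z := s * _ in D1 D2 *; clearbody w y z.
by apply/andP; split; lra.
Unshelve. all: by end_near. Qed.

Lemma poisson_limit k : a k n @[n --> \oo] --> lam ^+ k / k`!%:R * expR (- lam).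
Proof.
have E n : a k n = (a k n - lam ^+ k / k`!%:R * a 0 n) + lam ^+ k / k`!%:R * a 0 n.
  by rewrite subrK.
apply: (eq_cvgn E).
have -> : lam ^+ k / k`!%:R * expR (- lam) = 0 + lam ^+ k / k`!%:R * expR (- lam).
  by rewrite add0r.
by apply: cvgD; [exact: limit_ratio|apply: cvgMl_tmp; exact: limit0].
Qed.

End PoissonLimit.

Lemma gnp_pr_ltn (R : realType) n (p : R) (X : graph n -> nat) M :
  \sum_(j < M) gnp_pr p (fun G => X G == j) = gnp_pr p (fun G => (X G < M)%N).
Proof.
rewrite -gnp_mean_sum; apply: eq_gnp_mean => G; case: ltnP => XM; last first.
  by rewrite big1 // => j _; case: eqP => // e; move: XM; rewrite e leqNgt ltn_ord.
rewrite (bigD1 (Ordinal XM)) //= eqxx big1 ?addr0 // => j jX.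
by case: eqP => // e; move/eqP: jX; case; apply: val_inj; rewrite /= e.
Qed.

(** * The regime p = c n^(-1/d) *)

Section Asymptotics.
Local Open Scope classical_set_scope.
Variables (R : realType) (d : nat) (c : R).
Hypothesis d2 : (2 <= d)%N.
Hypothesis c0 : 0 < c.
Hypothesis c_small : (shape_base d)%:R * c <= 1.

Definition edge_pr (n : nat) : R := c / (n%:R `^ (d%:R)^-1).

Local Notation p := edge_pr.
Local Notation cross_size := (2 * (d + 1) * d)%N.

Let d0 : (0 < d)%N. Proof. exact: ltnW. Qed.

Let c1 : c <= 1.
Proof.
apply: le_trans c_small; rewrite ler_peMl ?(ltW c0) // ler1n.
by rewrite expn_gt0.
Qed.

Lemma edge_pr_ge0 n : 0 <= p n.
Proof. by rewrite divr_ge0 ?(ltW c0) ?powR_ge0. Qed.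

Lemma edge_pr_exp n : p n ^+ d = c ^+ d / n%:R.
Proof.
rewrite /p expr_div_n; congr (_ / _).
rewrite -powR_mulrn ?powR_ge0 // -powRrM mulVf ?powRr1 ?ler0n //.
by rewrite pnatr_eq0 -lt0n.
Qed.

Lemma edge_pr_natM n : (0 < n)%N -> n%:R * p n ^+ d = c ^+ d.
Proof. by move=> n0; rewrite edge_pr_exp mulrC divfK // pnatr_eq0 -lt0n. Qed.

Lemma edge_pr01 n : (0 < n)%N -> 0 <= p n <= 1.
Proof.
move=> n0; rewrite edge_pr_ge0 -(@expr_le1 _ d) ?edge_pr_ge0 // edge_pr_exp.
rewrite ler_pdivrMr ?ltr0n // mul1r; apply: le_trans (_ : 1 <= _); last by rewrite ler1n.
by rewrite exprn_ile1 ?(ltW c0).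
Qed.

Lemma edge_pr_cvg0 : p n @[n --> \oo] --> 0.
Proof.
apply/cvgr0Pnorm_lt => e e0; near=> n.
have n0 : (0 < n)%N by near: n; exact: nbhs_infty_gt.
rewrite ger0_norm ?edge_pr_ge0 // -(@ltr_pXn2r _ d) ?nnegrE ?edge_pr_ge0 ?(ltW e0) //.
rewrite edge_pr_exp ltr_pdivrMr ?ltr0n // mulrC -ltr_pdivrMr ?exprn_gt0 //.
by near: n; exact: nbhs_infty_gtr.
Unshelve. all: by end_near. Qed.

Definition poisson_rate : R :=
  c ^+ (2 * (d + 1) * d) / (2 ^+ (d + 1) * ((d + 1)`!)%:R).

Lemma ffact_ratio_cvg m : ((n ^_ m)%:R / n%:R ^+ m : R) @[n --> \oo] --> (1 : R).
Proof.
elim: m => [|m IHm].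
  apply: (@eq_cvgn _ _ (fun=> 1)) => [n|]; last exact: cvg_cst.
  by rewrite ffactn0 expr0 divr1.
have H : ((n - m)%N%:R / n%:R : R) @[n --> \oo] --> (1 : R).
  apply/cvgrPdist_lt => e e0; near=> n.
  have n0 : 0 < n%:R :> R by rewrite ltr0n; near: n; exact: nbhs_infty_gt.
  have mn : (m <= n)%N by near: n; exact: nbhs_infty_ge.
  rewrite natrB // mulrBl divff ?gt_eqF // opprB addrC subrK ger0_norm ?divr_ge0 ?ler0n //.
  rewrite ltr_pdivrMr // mulrC -ltr_pdivrMr //.
  by near: n; exact: nbhs_infty_gtr.
apply: (cvgM_eq _ (esym (mulr1 1)) IHm H) => n.
by rewrite ffactnSr natrM exprSr invfM mulrACA.
Unshelve. all: by end_near. Qed.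

(** The mean is exactly the rate times a ratio tending to 1: counting matchings yields the falling
    factorial, and p^d = c^d / n turns the power of p into the matching power of n. *)
Lemma cross_mean_cvg : cross_mean n (p n) d @[n --> \oo] --> poisson_rate.
Proof.
have E n : cross_mean n (p n) d =
    poisson_rate * ((n ^_ d.+1.*2)%:R / n%:R ^+ d.+1.*2).
  have count : (#|crosses n d| * (d.+1`! * 2 ^ d.+1) = n ^_ d.+1.*2)%N.
    have := card_matchings d.+1 [set: 'I_n]; rewrite cardsT card_ord => <-.
    congr (_ * _)%N; apply: eq_card => P; rewrite !inE.
    by rewrite sub_edges_in subsetT andbT.
  have f0 : (d.+1`!)%:R != 0 :> R by rewrite pnatr_eq0 -lt0n fact_gt0.
  have t0 : 2 ^+ d.+1 != 0 :> R by rewrite expf_neq0 // pnatr_eq0.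
  rewrite -count /cross_mean /poisson_rate addn1 {count}.
  move: (d.+1`!) f0 => F f0; rewrite !natrM natrX.
  have -> : (2 * d.+1 * d = d * d.+1.*2)%N by rewrite mul2n mulnC.
  rewrite exprM edge_pr_exp expr_div_n -exprM.
  set N := #|_|%:R; set T := 2 ^+ d.+1 in t0 *.
  set i := (n%:R ^+ _)^-1; clearbody N T i.
  by field; rewrite ?f0 ?t0.
apply: (cvgM_eq E (esym (mulr1 _))); first exact: cvg_cst.
exact: ffact_ratio_cvg.
Qed.

Let rate_gt0 : 0 < poisson_rate.
Proof. by rewrite divr_gt0 ?exprn_gt0 ?mulr_gt0 ?exprn_gt0 ?ltr0n ?fact_gt0. Qed.

Definition recursion_error (n : nat) : R :=
  cross_mean n (p n) d * p n +
  small_const R d * small_const R d * ((sparse_size d).+1%:R * p n).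

Let npd n : (0 < n)%N -> n%:R * p n ^+ d <= 1.
Proof. by move=> n0; rewrite edge_pr_natM // exprn_ile1 ?(ltW c0). Qed.

Lemma cross_count_cvg (k : nat) :
  gnp_pr (p n) (fun G : graph n => cross_count d G == k) @[n --> \oo] -->
  poisson_rate ^+ k / k`!%:R * expR (- poisson_rate).
Proof.
(* The value 0 at n = 0 keeps a within [0, 1] for every n and does not affect the limit. *)
pose a (k n : nat) :=
  if (0 < n)%N then gnp_pr (p n) (fun G : graph n => cross_count d G == k) else 0.
have ak : a k n @[n --> \oo] --> poisson_rate ^+ k / k`!%:R * expR (- poisson_rate).
  apply: (@poisson_limit _ a (fun n => cross_mean n (p n) d) recursion_error).
  - exact: cross_mean_cvg.
  - have -> : 0 = poisson_rate * 0 +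
        small_const R d * small_const R d * ((sparse_size d).+1%:R * 0) :> R.
      by rewrite !mulr0 addr0.
    apply: cvgD; first by apply: cvgM; [exact: cross_mean_cvg|exact: edge_pr_cvg0].
    by apply: cvgMl_tmp; apply: cvgMl_tmp; exact: edge_pr_cvg0.
  - move=> j n; rewrite /a; case: ifP => [n0|_]; last by rewrite lexx ler01.
    by rewrite gnp_pr_ge0 ?gnp_pr_le1 ?edge_pr01.
  - near=> n; have n0 : (0 < n)%N by near: n; exact: nbhs_infty_gt.
    move=> j; rewrite /a n0; have p01 := edge_pr01 n0.
    apply: le_trans (poisson_recursion _ d p01 j) _; apply: lerD.
      have /andP[p0 p1] := p01; rewrite ler_wpM2l ?cross_mean_ge0 // ler_iXnr //.
      by rewrite !muln_gt0 addn1 d0.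
    apply: le_trans (overlap_sum_le _ d p01) _.
    by rewrite ler_wpM2l ?mulr_ge0 ?ler0n //; exact: sparse_sum_le (npd n0).
  - near=> n; have n0 : (0 < n)%N by near: n; exact: nbhs_infty_gt.
    move=> M; have p01 := edge_pr01 n0.
    have -> : \sum_(j < M.+1) a j n = gnp_pr (p n) (fun G : graph n => (cross_count d G < M.+1)%N).
      by rewrite /a n0 gnp_pr_ltn.
    rewrite gnp_pr_le1 // andbT.
    rewrite lerBlDr; apply: le_trans (lerD (lexx _) (cross_count_tail _ d p01 M)).
    rewrite -gnp_meanD -{1}(gnp_mean_cst n (p n) 1); apply: gnp_mean_le => // G.
    by rewrite ltnS ltnNge; case: leqP; rewrite ?addr0 ?add0r.
apply: cvg_trans ak; apply: near_eq_cvg; near=> n.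
by rewrite /a ifT //; near: n; exact: nbhs_infty_gt.
Unshelve. all: by end_near. Qed.

Lemma bad_graph_cvg0 :
  gnp_pr (p n) (fun G : graph n => small_dense d G || contains_shape d G)
    @[n --> \oo] --> 0.
Proof.
pose bound n : R := (small_const R d * (sparse_size d).+1%:R + (shape_const d)%:R) * p n.
apply: (@cvg_norm_le0 _ _ bound); last first.
  have -> : 0 = (small_const R d * (sparse_size d).+1%:R + (shape_const d)%:R) * 0 :> R.
    by rewrite mulr0.
  by apply: cvgMl_tmp; exact: edge_pr_cvg0.
near=> n; have n0 : (0 < n)%N by near: n; exact: nbhs_infty_gt.
have p01 := edge_pr01 n0.
rewrite ger0_norm ?gnp_pr_ge0 // /bound mulrDl.
apply: (@le_trans _ _ (gnp_pr (p n) (small_dense d (n := n)) +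
                       gnp_pr (p n) (contains_shape d (n := n)))).
  rewrite -gnp_meanD; apply: gnp_mean_le => // G.
  by case: small_dense; case: contains_shape; rewrite /= ?addr0 ?add0r // lerDl.
apply: lerD; last first.
  apply: pr_contains_shape => //; rewrite edge_pr_natM //.
  apply: le_trans c_small; rewrite ler_wpM2l ?ler0n // ler_iXnr ?(ltW c0) //.
apply: le_trans (pr_small_dense _ _ p01) _; rewrite -mulrA ler_wpM2l ?ler0n //.
exact: sparse_sum_le (npd n0).
Unshelve. all: by end_near. Qed.

Lemma betti_distribution_cvg (K : fieldType) M :
  gnp_pr (p n) (fun G : graph n => (betti K (clique_complex G) d < M)%N) @[n --> \oo] -->
  \sum_(k < M) poisson_rate ^+ k / k`!%:R * expR (- poisson_rate).
Proof.
pose b n := gnp_pr (p n) (fun G : graph n => (betti K (clique_complex G) d < M)%N).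
pose a n := \sum_(k < M) gnp_pr (p n) (fun G : graph n => cross_count d G == k).
have ba : (b n - a n) @[n --> \oo] --> 0.
  apply: cvg_norm_le0 bad_graph_cvg0; near=> n.
  have n0 : (0 < n)%N by near: n; exact: nbhs_infty_gt.
  have p01 := edge_pr01 n0.
  rewrite /a /b gnp_pr_ltn -gnp_meanB; apply: le_trans (gnp_mean_norm p01 _) _.
  apply: gnp_mean_le => // G; case: (boolP (small_dense d G || contains_shape d G)).
    move=> _; case: (_ < M)%N; case: (_ < M)%N;
      by rewrite ?subrr ?subr0 ?sub0r ?normrN ?normr1 ?normr0 ?ler01.
  by rewrite negb_or => /andP[sG cG]; rewrite betti_cross_count // subrr normr0.
set l := \sum_(k < M) _; have -> : l = 0 + l by rewrite add0r.
apply: (@eq_cvgn _ _ (fun n => (b n - a n) + a n)).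
  by move=> n; rewrite subrK.
by apply: cvgD => //; exact: cvg_sum_ord cross_count_cvg.
Unshelve. all: by end_near. Qed.

(** Both variables take natural values, so their distribution functions at x are probabilities of
    lying below an M that depends on x alone. *)
Lemma natr_le_bound (x : R) : exists M : nat, forall k : nat, (k%:R <= x) = (k < M)%N.
Proof.
case: (leP 0 x) => x0; first by exists (Num.truncn x).+1 => k; rewrite ltnS truncn_ge_nat.
by exists 0%N => k; rewrite ltn0; apply/negbTE; rewrite -ltNge (lt_le_trans x0).
Qed.

Lemma cdf_poisson (x : R) M : (forall k : nat, (k%:R <= x) = (k < M)%N) ->
  cdf (poisson_rv poisson_rate) x =
  (\sum_(k < M) poisson_rate ^+ k / k`!%:R * expR (- poisson_rate))%:E.
Proof.
move=> xM; rewrite /cdf /distribution /pushforward /= /poisson_prob rate_gt0.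
have -> : poisson_rv poisson_rate @^-1` `]-oo, x] = `I_M.
  by apply/seteqP; split => k /=; rewrite in_itv /= /nat_real xM.
rewrite esum_fset; [|exact: finite_II|by move=> k _; rewrite lee_fin poisson_pmf_ge0].
rewrite -fsbig_ord sumEFin; congr (_%:E); apply: eq_bigr => k _.
by rewrite /poisson_pmf rate_gt0.
Qed.

Lemma cdf_betti (K : fieldType) n (x : R) M : (0 < n)%N ->
    (forall k : nat, (k%:R <= x) = (k < M)%N) ->
  cdf (betti_rv K d n (p n)) x =
  (gnp_pr (p n) (fun G : graph n => (betti K (clique_complex G) d < M)%N))%:E.
Proof.
move=> n0 xM; rewrite /cdf /distribution /pushforward /= /gnp_prob edge_pr01 //.
congr (_%:E); rewrite /gnp_pr /gnp_mean big_mkcond /=; apply: eq_bigr => G _.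
rewrite -xM; set B := (_ <= x).
have -> : (G \in betti_rv K d n (p n) @^-1` `]-oo, x]) = B.
  by apply/idP/idP => [/set_mem|xB]; [|apply/mem_set]; rewrite /= in_itv.
by case: B; rewrite ?mulr1 ?mulr0.
Qed.

End Asymptotics.

Theorem theorem1p2 (R : realType) (d : nat) (hd : (2 <= d)%N) :
  exists eps : R, 0 < eps /\
    forall (c : R) (K : fieldType), 0 < c -> c < eps ->
      cvg_in_distribution
        (fun n : nat => betti_rv K d n (c / (n%:R `^ (d%:R)^-1)))
        (poisson_rv
           (c ^+ (2 * (d + 1) * d) / (2 ^+ (d + 1) * ((d + 1)`!)%:R))).
Proof.
have base_gt0 : 0 < (shape_base d)%:R :> R by rewrite ltr0n expn_gt0.
(* Since n p^d = c^d <= c, this is the smallness that the series in [pr_contains_shape] asks for. *)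
exists (shape_base d)%:R^-1; split; first by rewrite invr_gt0.
move=> c K c0 c_eps x _.
have c_small : (shape_base d)%:R * c <= 1.
  by rewrite -ler_pdivlMl // mulr1 ltW.
have [M xM] := natr_le_bound x.
rewrite (cdf_poisson d c0 xM).
have cdfE n : (0 < n)%N -> cdf (betti_rv K d n (c / (n%:R `^ (d%:R)^-1))) x =
    (gnp_pr (edge_pr d c n)
      (fun G : graph n => (betti K (clique_complex G) d < M)%N))%:E.
  by move=> n0; rewrite -(cdf_betti hd c0 c_small K n0 xM).
apply/fine_cvgP; split.
  near=> n; rewrite cdfE //; near: n; exact: nbhs_infty_gt.
have := @betti_distribution_cvg _ _ _ hd c0 c_small K M; apply: cvg_trans.
apply: near_eq_cvg; near=> n; rewrite [RHS](congr1 fine (cdfE n _)) //.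
near: n; exact: nbhs_infty_gt.
Unshelve. all: by end_near. Qed.
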